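(* Let $S_0$ be a compact, connected, non-positively curved special cube complex, $\Gamma$ its fundamental group, $X$ its universal covering, $\ell:\vec{\mathcal E}(X)\to\Sigma_0$ a $\Gamma$-invariant admissible edge labeling on $X$ with $\ell$ surjective, and $o\in X^{(0)}$. Suppose $\Gamma$ acts vertex-transitively on $X$. Let $S$ be a finite generating set of $\Gamma$ such that $S^{-1}=S$. Then the set \[ S\cup\{A_{o,\sigma}\mid\sigma\text{ a label-isomorphism}\}\cup\{A_{\alpha,\sigma}\mid\alpha\in\Sigma,\ \sigma\text{ a label-isomorphism compatible with }\alpha\} \] generates a dense subgroup of $\mathrm{Aut}(X)$. Here $A_{o,\sigma}$ and $A_{\alpha,\sigma}$ (where $\alpha$ is regarded as a one-letter word in $\mathcal L_o$) are the elements of the stabilizer $G_o$ of $o$ defined in the context.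
   Context: $\mathrm{Aut}(X)$ is the group of cubical automorphisms of $X$ with the compact-open topology; $G_o$ is the stabilizer of $o$ in $\mathrm{Aut}(X)$; $\Gamma$ acts by deck transformations and is viewed as a subgroup of $\mathrm{Aut}(X)$. ''Special'' is in the sense of Haglund--Wise. Labelings. $\vec{\mathcal E}(X)$ is the set of oriented edges, $\vec{\mathcal E}(X)_v$ those starting at $v$. Oriented edges are parallel if they cross the same hyperplane in the same direction. Two edges with exactly one common endpoint span a square if they are two sides of a common square. An admissible edge labeling is a map $\ell:\vec{\mathcal E}(X)\to\Sigma_0$ to a finite set $\Sigma_0$ with fixpoint-free involution $s\mapsto s^{-1}$ such that: (A1) parallel oriented edges have equal labels and reversing orientation inverts the label; (A2) $\ell|_{\vec{\mathcal E}(X)_v}$ is injective for each vertex $v$; (A3) if $e_1,e_2\in\vec{\mathcal E}(X)_v$, $e_1',e_2'\in\vec{\mathcal E}(X)_w$ with $\ell(e_i)=\ell(e_i')$ for $i=1,2$, then $e_1,e_2$ span a square iff $e_1',e_2'$ do. It is $\Gamma$-invariant if $\ell(g(e))=\ell(e)$ for all $g\in\Gamma$ and all $e$. As $\Gamma$ is vertex-transitive and $\ell$ is surjective, every label in $\Sigma_0$ occurs exactly once among the outgoing edges at every vertex. Labels and words. $s,t\in\Sigma_0$ commute, $[s,t]=1$, if outgoing edges labeled $s$ and $t$ at some (equivalently every) vertex span a square. $\Sigma$ is the set of nonempty subsets of $\Sigma_0$ whose distinct elements commute pairwise; $s$ is identified with $\{s\}$, and $\alpha^{-1}=\{s^{-1}\mid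 s\in\alpha\}$. For $\alpha,\beta\in\Sigma$, $[\alpha,\beta]=1$ means every $s\in\alpha$ commutes with every $t\in\beta$. An oriented diagonal is an ordered pair of opposite vertices $(v,w)$ of a cube $C$ of dimension $\ge 1$; its label is the set of labels of edges of $C$ starting at $v$; at each vertex the outgoing diagonals correspond bijectively to $\Sigma$. A cube path is a finite concatenation of oriented diagonals; its word is the sequence of labels in $\Sigma^*$. $\mathcal L_o^{cube}$ is the set of words of cube paths starting at $o$; $\epsilon$ is the empty word. A word also denotes the endpoint of its path. A word is reducible if its path crosses some hyperplane more than once, reduced otherwise. A cube path with consecutive cubes $C_1,\dots,C_n$ is normal if it crosses no hyperplane more than once and for each $1\le i<n$ no hyperplane meeting $C_{i+1}$ crosses all hyperplanes meeting $C_i$. $\mathcal L_o\subset\mathcal L_o^{cube}$ is the set of words of normal cube paths from $o$; each vertex of $X$ is the endpoint of exactly one normal cube path from $o$ (Niblo--Reeves), and $\mathrm{norm}(w')\in\mathcal L_o$ denotes the normal word with the same endpoint as $w'\in\mathcal L_o^{cube}$. For $w=\beta_1\cdots\beta_m\in\mathcal L_o$ with $m\ge1$ put $w_-=\beta_1\cdots\beta_{m-1}$, $w_{end}=\beta_m$. Label-isomorphism: a bijection $\sigma:\Sigma_0\to\Sigma_0$ with $[s,t]=1\Leftrightarrow[\sigma(s),\sigma(t)]=1$, extended to $\Sigma$ elementwise. $\sigma(\alpha)=\alpha$ means $\sigma(s)=s$ for all $s\in\alpha$. For a reduced word $v\ne\epsilon$, $\sigma$ is compatible with $v$ if for every $\alpha\in\Sigma$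 with $v\alpha$ reducible, $\sigma(\alpha)=\alpha$ and $\sigma(\beta)=\beta$ for every $\beta\in\Sigma$ with $[\alpha,\beta]=1$. Portrait: for $g\in G_o$ and a vertex $w$, ${}_{w}\sigma(g):\Sigma\to\Sigma$ sends the label of an outgoing diagonal $d$ at $w$ to the label of $g(d)$. An element of $G_o$ is determined by these maps. Types: for $v\ne o$ let $\hat h_1,\dots,\hat h_n$ be the hyperplanes that intersect an edge incident to $v$ and separate $o$ from $v$, and $h_i$ the halfspace of $\hat h_i$ containing $v$. A vertex $w$ is of Type 1 relative to $(o,v)$ if $w\notin h_1\cap\dots\cap h_n$; of Type 2 if $w\in h_1\cap\dots\cap h_n$ and $w$ lies in the carrier of some $\hat h_i$; of Type 3 otherwise. For a label-isomorphism $\sigma$ and $\beta\in\Sigma$ let $\tau(\sigma,\beta)=\big(\prod_{s\in\beta}(\sigma(s^{-1}),\sigma(s)^{-1})\big)\circ\sigma$, where $(a,b)$ is the permutation of $\Sigma_0$ swapping $a$ and $b$ (identity if $a=b$); the factors commute, and $\tau(\sigma,\beta)$ is a label-isomorphism. $A_{o,\sigma}=A_{\epsilon,\sigma}\in G_o$ is the automorphism whose portrait $({}_wA_{\epsilon,\sigma})_w$ is given for $w\in\mathcal L_o$ recursively by ${}_{\epsilon}A_{\epsilon,\sigma}=\sigma$ and ${}_wA_{\epsilon,\sigma}=\tau({}_{w_-}A_{\epsilon,\sigma},w_{end})$ for $w\ne\epsilon$. For $v\in\mathcal L_o\setminus\{\epsilon\}$ and $\sigma$ compatible with $v$, $A_{v,\sigma}\in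 G_o$ is the automorphism whose portrait is given for $w\in\mathcal L_o$ by ${}_wA_{v,\sigma}=\mathrm{id}$ if $w$ is of Type 1 relative to $(o,v)$, ${}_wA_{v,\sigma}=\sigma$ if $w$ is of Type 2, and ${}_wA_{v,\sigma}=\tau({}_{w_-}A_{v,\sigma},w_{end})$ if $w$ is of Type 3. These portraits do define elements of $G_o$; $A_{v,\sigma}$ has ${}_vA_{v,\sigma}=\sigma$ and fixes all vertices of Type 1 and 2 relative to $(o,v)$. *)

(* Defs.v *)
From HB Require Import structures.
From Stdlib Require Import Relation_Operators.
From mathcomp Require Import all_boot all_order fingroup perm all_algebra.
From mathcomp Require Import generic_quotient.
From mathcomp Require Import all_classical reals topology normedtype.
Set Implicit Arguments.
Unset Strict Implicit.
Unset Printing Implicit Defensive.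
Import Order.TTheory GRing.Theory Num.Theory.
Import numFieldNormedType.Exports.
Local Open Scope classical_set_scope.

(** * Combinatorial cubes *)

Definition cube (n : nat) := {ffun 'I_n -> bool}.

Definition hdist n (x y : cube n) : nat := #|[pred i | x i != y i]|.

Definition isometric m n (f : {ffun cube m -> cube n}) : bool :=
  [forall x, forall y, hdist (f x) (f y) == hdist x y].

(* The Hamming isometric maps are exactly the restrictions to the vertices of
   the isometries of [0,1]^m onto the m-dimensional faces of [0,1]^n. *)
Definition embedding m n := {f : {ffun cube m -> cube n} | isometric f}.

Definition emb_fun m n (f : embedding m n) : cube m -> cube n := val f.
Coercion emb_fun : embedding >-> Funclass.

Definition cube0 n : cube n := [ffun=> false].
Definition cube1 n : cube n := [ffun=> true].
Definition cubeflip n (x : cube n) (i : 'I_n) : cube n :=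
  [ffun k => (k == i) (+) x k].

Lemma vertex_emb_isometric n (x : cube n) : isometric [ffun _ : cube 0 => x].
Proof.
apply/forallP=> a; apply/forallP=> b; rewrite !ffunE; apply/eqP.
by rewrite /hdist !eq_card0 // => i; rewrite !inE ?eqxx //; case: i.
Qed.

Definition vertex_emb n (x : cube n) : embedding 0 n :=
  exist (fun f => is_true (isometric f)) _ (vertex_emb_isometric x).

Definition edge_fun n (x : cube n) (i : 'I_n) : {ffun cube 1 -> cube n} :=
  [ffun b : cube 1 => if b ord0 then cubeflip x i else x].

Lemma edge_fun_isometric n (x : cube n) (i : 'I_n) : isometric (edge_fun x i).
Proof.
apply/forallP=> a; apply/forallP=> b; apply/eqP.
have hn m (y z : cube m) : hdist y z = \sum_k (y k != z k).
  rewrite /hdist -sum1_card big_mkcond /=; apply: eq_bigr => k _.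
  by rewrite inE; case: ifP.
rewrite !hn big_ord1 (bigD1 i) //= big1 => [|k /negPf ki].
  by rewrite !ffunE addn0; case: (a _); case: (b _); rewrite ?ffunE eqxx //=;
    case: (x i).
by rewrite !ffunE; case: (a _); case: (b _); rewrite ?ffunE ?ki /= ?eqxx.
Qed.

(* the edge of [0,1]^n that starts at the vertex x and is parallel to the i-th
   coordinate axis *)
Definition edge_emb n (x : cube n) (i : 'I_n) : embedding 1 n :=
  exist (fun f => is_true (isometric f)) _ (edge_fun_isometric x i).

(** * Cube complexes *)

(* [cell n] is the type of parametrized n-cubes, that is of the isometric
   identifications of [0,1]^n with an n-cube of the complex: each n-cube of the
   complex occurs once for every symmetry of [0,1]^n.  In particular [cell 0]
   is the set of vertices and [cell 1] the set of oriented edges.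
   [face f c] is the restriction of c along f; [face_free] says that an n-cube
   is not folded, i.e. not glued to itself by a symmetry of [0,1]^n. *)
Record cubeComplex := CubeComplex {
  cell :> nat -> Type;
  face : forall m n, embedding m n -> cell n -> cell m;
  face_id : forall n (f : embedding n n) c, f =1 id -> face f c = c;
  face_comp : forall k m n (f : embedding m n) (g : embedding k m)
      (h : embedding k n) c, h =1 f \o g -> face h c = face g (face f c);
  face_free : forall n (f g : embedding n n) c, face f c = face g c -> f = g }.

Section Cells.
Variable X : cubeComplex.

Definition vertex n (c : X n) (x : cube n) : X 0 := face (vertex_emb x) c.

Definition edge n (c : X n) (x : cube n) (i : 'I_n) : X 1 :=
  face (edge_emb x i) c.

Definition esrc (e : X 1) : X 0 := vertex e (cube0 1).
Definition etgt (e : X 1) : X 0 := vertex e (cube1 1).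
Definition erev (e : X 1) : X 1 := edge e (cube1 1) ord0.

Definition edge_of n (e : X 1) (c : X n) : Prop :=
  exists f : embedding 1 n, e = face f c.

Definition vertex_of n (v : X 0) (c : X n) : Prop := exists x, v = vertex c x.

(* i0 and i1 are the two coordinates of a square *)
Definition i0 : 'I_2 := ord0.
Definition i1 : 'I_2 := ord_max.

Definition corner (e e' : X 1) : Prop :=
  exists c : X 2, e = edge c (cube0 2) i0 /\ e' = edge c (cube0 2) i1.

Definition elementary_parallel (e e' : X 1) : Prop :=
  exists c : X 2, e = edge c (cube0 2) i0 /\
                  e' = edge c (cubeflip (cube0 2) i1) i0.

Definition parallel : X 1 -> X 1 -> Prop :=
  clos_refl_sym_trans (X 1) elementary_parallel.

(* A hyperplane is identified with the set of oriented edges crossing it. *)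
Definition dual_hyperplane (e : X 1) : set (X 1) :=
  [set e' | parallel e e' \/ parallel e (erev e')].

Definition hyperplane (H : set (X 1)) : Prop := exists e, H = dual_hyperplane e.

Definition meets n (H : set (X 1)) (c : X n) : Prop :=
  exists2 e, edge_of e c & H e.

Definition crosses (H K : set (X 1)) : Prop :=
  exists c : X 2, H (edge c (cube0 2) i0) /\ K (edge c (cube0 2) i1).

(* The links of vertices are flag simplicial complexes: a cube c with its
   vertex 0 at v is a simplex of the link of v, with vertices the edges of c
   that start at v. *)
Record nonpositively_curved : Prop := NonPositivelyCurved {
  link_simplex : forall n (c : X n), injective (edge c (cube0 n));
  link_simplicial : forall n (c c' : X n),
    vertex c (cube0 n) = vertex c' (cube0 n) ->
    edge c (cube0 n) =1 edge c' (cube0 n) -> c = c';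
  link_flag : forall (v : X 0) n (e : 'I_n -> X 1),
    injective e -> (forall i, esrc (e i) = v) ->
    (forall i j, i != j -> corner (e i) (e j)) ->
    exists c : X n, vertex c (cube0 n) = v /\ edge c (cube0 n) =1 e }.

Definition self_crossing (H : set (X 1)) : Prop := crosses H H.

Definition two_sided (H : set (X 1)) : Prop :=
  forall e, H e -> ~ parallel e (erev e).

Definition directly_self_osculates (H : set (X 1)) : Prop :=
  exists e e', [/\ H e, parallel e e', esrc e = esrc e', e <> e'
                 & ~ corner e e'].

Definition osculate (H K : set (X 1)) : Prop :=
  exists e e', [/\ H e, K e', esrc e = esrc e' & ~ corner e e'].

(* Haglund-Wise *)
Record special : Prop := Special {
  special_embedded : forall H, hyperplane H -> ~ self_crossing H;
  special_two_sided : forall H, hyperplane H -> two_sided H;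
  special_self_osculation : forall H, hyperplane H ->
    ~ directly_self_osculates H;
  special_inter_osculation : forall H K, hyperplane H -> hyperplane K ->
    H <> K -> ~ (crosses H K /\ osculate H K) }.

(** Edge paths *)

Fixpoint edge_path (v : X 0) (p : seq (X 1)) (w : X 0) : Prop :=
  if p is e :: p' then esrc e = v /\ edge_path (etgt e) p' w else v = w.

Inductive homotopy_step (v w : X 0) : seq (X 1) -> seq (X 1) -> Prop :=
| Backtrack p e q : edge_path v p (esrc e) -> edge_path (esrc e) q w ->
    homotopy_step v w (p ++ q) (p ++ [:: e; erev e] ++ q)
| Square p (c : X 2) q :
    edge_path v p (vertex c (cube0 2)) -> edge_path (vertex c (cube1 2)) q w ->
    homotopy_step v w
      (p ++ [:: edge c (cube0 2) i0; edge c (cubeflip (cube0 2) i0) i1] ++ q)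
      (p ++ [:: edge c (cube0 2) i1; edge c (cubeflip (cube0 2) i1) i0] ++ q).

Definition homotopic (v w : X 0) : seq (X 1) -> seq (X 1) -> Prop :=
  clos_refl_sym_trans (seq (X 1)) (homotopy_step v w).

(* triviality of the edge-path group of the 2-skeleton *)
Definition simply_connected : Prop :=
  (forall v w, exists p, edge_path v p w) /\
  (forall v p, edge_path v p v -> homotopic v v p [::]).

End Cells.

(** * Cubical maps, coverings, automorphisms *)

Record cubicalMap (X Y : cubeComplex) := CubicalMap {
  cmap :> forall n, X n -> Y n;
  cmap_face : forall m n (f : embedding m n) c,
    cmap (face f c) = face f (cmap c) }.

(* every cube of Y lifts uniquely to X, given a lift of one of its vertices *)
Definition covering (X Y : cubeComplex) (p : cubicalMap X Y) : Prop :=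
  (forall y : Y 0, exists x : X 0, p 0 x = y) /\
  (forall n (d : Y n) (v : X 0), p 0 v = vertex d (cube0 n) ->
     exists! c : X n, vertex c (cube0 n) = v /\ p n c = d).

Definition universal_covering (X Y : cubeComplex) (p : cubicalMap X Y) : Prop :=
  covering p /\ simply_connected X.

Record aut (X : cubeComplex) := Aut {
  aut_fun :> forall n, X n -> X n;
  aut_inv : forall n, X n -> X n;
  aut_face : forall m n (f : embedding m n) c,
    aut_fun (face f c) = face f (aut_fun c);
  aut_funK : forall n, cancel (@aut_fun n) (@aut_inv n);
  aut_invK : forall n, cancel (@aut_inv n) (@aut_fun n) }.

Section AutGroup.
Variable X : cubeComplex.
Implicit Types g h : aut X.

Lemma aut_eq g h : (forall n c, g n c = h n c) -> g = h.
Proof.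
case: g h => [a a' af aK a'K] [b b' bf bK b'K] /= ab.
have ? : a = b by apply: functional_extensionality_dep => n; exact/funext/ab.
subst b.
have ? : a' = b'.
  apply: functional_extensionality_dep => n; apply/funext => c.
  by rewrite -{1}(b'K n c) aK.
by subst b'; congr Aut; exact: Prop_irrelevance.
Qed.

Lemma aut_inv_face g m n (f : embedding m n) c :
  aut_inv g (face f c) = face f (aut_inv g c).
Proof. by rewrite -{1}(aut_invK g c) -aut_face aut_funK. Qed.

Definition aut_one : aut X :=
  @Aut X (fun n c => c) (fun n c => c) (fun _ _ _ _ => erefl)
    (fun _ _ => erefl) (fun _ _ => erefl).

Definition aut_opp g : aut X :=
  @Aut X (aut_inv g) (aut_fun g) (@aut_inv_face g)
    (@aut_invK X g) (@aut_funK X g).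

Lemma aut_mul_face g h m n (f : embedding m n) c :
  g m (h m (face f c)) = face f (g n (h n c)).
Proof. by rewrite !aut_face. Qed.

Definition aut_mul g h : aut X :=
  @Aut X (fun n c => g n (h n c)) (fun n c => aut_inv h (aut_inv g c))
    (aut_mul_face g h)
    (fun n => can_comp (@aut_funK X g n) (@aut_funK X h n))
    (fun n => can_comp (@aut_invK X h n) (@aut_invK X g n)).

HB.instance Definition _ := gen_eqMixin (aut X).
HB.instance Definition _ := gen_choiceMixin (aut X).

Lemma aut_mulA : associative aut_mul.
Proof. by move=> ? ? ?; exact: aut_eq. Qed.
Lemma aut_mul1 : left_id aut_one aut_mul.
Proof. by move=> ?; exact: aut_eq. Qed.
Lemma aut_mulr1 : right_id aut_one aut_mul.
Proof. by move=> ?; exact: aut_eq. Qed.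
Lemma aut_mulV : left_inverse aut_one aut_opp aut_mul.
Proof. by move=> g; apply: aut_eq => n c /=; rewrite aut_funK. Qed.
Lemma aut_mulrV : right_inverse aut_one aut_opp aut_mul.
Proof. by move=> g; apply: aut_eq => n c /=; rewrite aut_invK. Qed.

HB.instance Definition _ := isGroup.Build (aut X)
  aut_mulA aut_mul1 aut_mulr1 aut_mulV aut_mulrV.

End AutGroup.

Definition is_subgroup (G : groupType) (H : set G) : Prop :=
  H 1%g /\ forall x y, H x -> H y -> H (x * y^-1)%g.

Definition generated_subgroup (G : groupType) (A : set G) : set G :=
  smallest (@is_subgroup G) A.

(* For a universal covering p : X -> Y this is the fundamental group of Y, as a
   subgroup of the automorphism group of X. *)
Definition deck (X Y : cubeComplex) (p : cubicalMap X Y) : set (aut X) :=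
  [set g | forall n (c : X n), p n (g n c) = p n c].

(** * Geometric realization and the compact-open topology *)

Section Realization.
Variable R : realType.
Local Open Scope ring_scope.

Definition solid n : set 'rV[R]_n := [set t | forall i, 0 <= t ord0 i <= 1].
Arguments solid : clear implicits.

(* the affine extension of f *)
Definition affine m n (f : embedding m n) (t : 'rV[R]_m) : 'rV[R]_n :=
  \row_k ((f (cube0 m) k)%:R + \sum_i t ord0 i *
     ((f (cubeflip (cube0 m) i) k)%:R - (f (cube0 m) k)%:R)).

Variable X : cubeComplex.

(* the disjoint union of one copy of [0,1]^n for every c : X n *)
Definition cubes := {c : {classic {n & X n}} & solid (projT1 c)}.

Definition cube_point n (c : X n) (t : solid n) : cubes :=
  existT (fun c : {classic {n & X n}} => set_type (solid (projT1 c)))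
    (existT _ n c) t.

Inductive glue : cubes -> cubes -> Prop :=
| Glue m n (f : embedding m n) (c : X n) (s : solid m) (t : solid n) :
    val t = affine f (val s) ->
    glue (cube_point (face f c) s) (cube_point c t).

Definition glued (x y : cubes) : bool :=
  `[< clos_refl_sym_trans cubes glue x y >].

Lemma glued_equiv : equiv_class_of glued.
Proof.
split=> [x|x y|y x z].
- exact/asboolP/rst_refl.
- by apply/asboolP/asboolP => ?; exact: rst_sym.
- by move=> /asboolP xy /asboolP yz; apply/asboolP; exact: rst_trans xy yz.
Qed.

Canonical glued_equivRel := EquivRelPack glued_equiv.

(* with the weak (CW) topology *)
Definition realization := quotient_topology {eq_quot glued_equivRel}%qT.

HB.instance Definition _ := Topological.on realization.

End Realization.

Section RealizedAut.
Variables (R : realType) (X : cubeComplex).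
Local Open Scope quotient_scope.

Definition cubes_aut (g : aut X) (x : cubes R X) : cubes R X :=
  let: existT c t := x in
  @cube_point R X (projT1 c) (g (projT1 c) (projT2 c)) t.

Definition realization_aut (g : aut X) (x : realization R X) :
    realization R X := \pi_(realization R X) (cubes_aut g (repr x)).

Lemma realization_autE g (x : cubes R X) :
  realization_aut g (\pi_(realization R X) x) =
  \pi_(realization R X) (cubes_aut g x).
Proof.
suff key y z : clos_refl_sym_trans _ (@glue R X) y z ->
    clos_refl_sym_trans _ (@glue R X) (cubes_aut g y) (cubes_aut g z).
  apply/eqquotP/asboolP/key/asboolP.
  by have /eqquotP := reprK (\pi_(realization R X) x).
elim=> [_ _ [m n f c s t st]|?|? ? _|? ? ? _ ? _] /=.
- by rewrite aut_face; apply: rst_step; exact: Glue.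
- exact: rst_refl.
- exact: rst_sym.
- exact: rst_trans.
Qed.

(* the group of cubical automorphisms with the compact-open topology *)
Definition autTop :=
  initial_topology
    (realization_aut :
      aut X -> {compact-open, realization R X -> realization R X}).

HB.instance Definition _ := Topological.on autTop.

End RealizedAut.

(** * Labelings *)

Section Labelings.
Variable X : cubeComplex.
Variables (Sigma0 : finType) (inv : Sigma0 -> Sigma0) (l : X 1 -> Sigma0).

Definition span_square (e e' : X 1) : Prop :=
  (exists! v, vertex_of v e /\ vertex_of v e') /\
  (exists c : X 2, edge_of e c /\ edge_of e' c).

Record admissible_labeling : Prop := AdmissibleLabeling {
  label_invK : involutive inv;
  label_inv_neq : forall s, inv s <> s;
  label_parallel : forall e e', parallel e e' -> l e = l e';
  label_rev : forall e, l (erev e) = inv (l e);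
  label_inj : forall e e', esrc e = esrc e' -> l e = l e' -> e = e';
  label_square : forall v w e1 e2 e1' e2',
    esrc e1 = v -> esrc e2 = v -> esrc e1' = w -> esrc e2' = w ->
    l e1 = l e1' -> l e2 = l e2' ->
    (span_square e1 e2 <-> span_square e1' e2') }.

Definition commuting (s t : Sigma0) : Prop :=
  exists e e', [/\ esrc e = esrc e', l e = s, l e' = t & span_square e e'].

(* Sigma, as a subset of {set Sigma0} *)
Definition Sigma (a : {set Sigma0}) : Prop :=
  a != finset.set0 /\ {in a &, forall s t, s != t -> commuting s t}.

Definition Sigma_commuting (a b : {set Sigma0}) : Prop :=
  {in a & b, forall s t, commuting s t}.

(* The oriented diagonal from the vertex 0 to the vertex (1, .., 1) of a
   parametrized cube of dimension n.+1; changing the order of the coordinates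
   gives the same diagonal. *)
Definition diagonal := {n : nat & X n.+1}.
Definition dcube (d : diagonal) : X (projT1 d).+1 := projT2 d.
Definition dsrc (d : diagonal) : X 0 := vertex (dcube d) (cube0 _).
Definition dtgt (d : diagonal) : X 0 := vertex (dcube d) (cube1 _).
Definition dlabel (d : diagonal) : {set Sigma0} :=
  [set l (edge (dcube d) (cube0 _) i) | i in 'I_(projT1 d).+1]%SET.

Definition aut_diagonal (g : aut X) (d : diagonal) : diagonal :=
  existT (fun n => X n.+1) (projT1 d) (g _ (dcube d)).

Fixpoint cube_path (v : X 0) (p : seq diagonal) (w : X 0) : Prop :=
  if p is d :: p' then dsrc d = v /\ cube_path (dtgt d) p' w else v = w.

Definition path_word (p : seq diagonal) : seq {set Sigma0} := map dlabel p.

Definition crosses_twice (p : seq diagonal) : Prop :=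
  exists p1 d p2 d' p3 H, [/\ p = p1 ++ d :: p2 ++ d' :: p3, hyperplane H,
    meets H (dcube d) & meets H (dcube d')].

Definition normal_path (p : seq diagonal) : Prop :=
  ~ crosses_twice p /\
  forall p1 d d' p2, p = p1 ++ d :: d' :: p2 ->
    ~ exists H, [/\ hyperplane H, meets H (dcube d') &
        forall K, hyperplane K -> meets K (dcube d) -> crosses H K].

(* v and w lie in the same component of the complement of H *)
Definition same_side (H : set (X 1)) (v w : X 0) : Prop :=
  exists2 p, edge_path v p w & forall p1 e p2, p = p1 ++ e :: p2 -> ~ H e.

Definition in_carrier (w : X 0) (H : set (X 1)) : Prop :=
  exists n (c : X n), meets H c /\ vertex_of w c.

Definition label_isomorphism (sigma : {perm Sigma0}) : Prop :=
  forall s t, commuting s t <-> commuting (sigma s) (sigma t).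

Definition fixes (sigma : {perm Sigma0}) (a : {set Sigma0}) : Prop :=
  {in a, forall s, sigma s = s}.

(* (f * g)%g is the permutation g \o f *)
Definition tau (sigma : {perm Sigma0}) (b : {set Sigma0}) : {perm Sigma0} :=
  (sigma * \prod_(s in b) tperm (sigma (inv s)) (inv (sigma s)))%g.

(* the portrait of g at w is sigma, extended elementwise to Sigma *)
Definition portrait_at (g : aut X) (w : X 0) (sigma : {perm Sigma0}) : Prop :=
  forall d, dsrc d = w ->
    dlabel (aut_diagonal g d) = [set sigma s | s in dlabel d]%SET.

Section Basepoint.
Variable o : X 0.

Definition word_end (w : seq {set Sigma0}) (x : X 0) : Prop :=
  exists2 p, cube_path o p x & path_word p = w.

Definition reducible (w : seq {set Sigma0}) : Prop :=
  exists p x, [/\ cube_path o p x, path_word p = w & crosses_twice p].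

Definition normal_word (w : seq {set Sigma0}) : Prop :=
  exists p x, [/\ cube_path o p x, path_word p = w & normal_path p].

Definition compatible (sigma : {perm Sigma0}) (v : seq {set Sigma0}) : Prop :=
  forall a, Sigma a -> reducible (rcons v a) ->
    fixes sigma a /\
    forall b, Sigma b -> Sigma_commuting a b -> fixes sigma b.

(* the hyperplanes that meet an edge incident to v and separate o from v *)
Definition last_hyperplane (v : X 0) (H : set (X 1)) : Prop :=
  [/\ hyperplane H, (exists2 e, H e & vertex_of v e) & ~ same_side H o v].

Definition in_last_halfspaces (v w : X 0) : Prop :=
  forall H, last_hyperplane v H -> same_side H v w.

Definition type1 (v w : X 0) : Prop := ~ in_last_halfspaces v w.

Definition type2 (v w : X 0) : Prop :=
  in_last_halfspaces v w /\ exists2 H, last_hyperplane v H & in_carrier w H.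

Definition type3 (v w : X 0) : Prop := ~ type1 v w /\ ~ type2 v w.

Definition stabilizer : set (aut X) := [set g | g 0 o = o].

(* [is_A_root sigma g] : g is the automorphism A_{o,sigma} *)
Definition is_A_root (sigma : {perm Sigma0}) (g : aut X) : Prop :=
  stabilizer g /\
  forall w x, normal_word w -> word_end w x ->
    portrait_at g x (foldl tau sigma w).

(* The cases are exhaustive: o is of type 1, since the last edge of a geodesic
   from o to v crosses one of the hyperplanes of [last_hyperplane v].
   [A_portrait v sigma w pi] : the element of the portrait of A_{v,sigma} at
   the vertex denoted by the normal word w is pi; v is given as a vertex. *)
Inductive A_portrait (v : X 0) (sigma : {perm Sigma0}) :
    seq {set Sigma0} -> {perm Sigma0} -> Prop :=
| A_type1 w x : normal_word w -> word_end w x -> type1 v x ->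
    A_portrait v sigma w 1%g
| A_type2 w x : normal_word w -> word_end w x -> type2 v x ->
    A_portrait v sigma w sigma
| A_type3 w b x pi : normal_word (rcons w b) -> word_end (rcons w b) x ->
    type3 v x -> A_portrait v sigma w pi ->
    A_portrait v sigma (rcons w b) (tau pi b).

(* [is_A v sigma g] : g is the automorphism A_{v,sigma} *)
Definition is_A (v : seq {set Sigma0}) (sigma : {perm Sigma0}) (g : aut X) :
    Prop :=
  stabilizer g /\
  exists2 y, word_end v y &
    forall w x pi, word_end w x -> A_portrait y sigma w pi ->
      portrait_at g x pi.

End Basepoint.
End Labelings.

(* Main.v *)
Require Import Defs.
From Stdlib Require Import Relation_Operators.
From mathcomp Require Import all_boot all_order fingroup perm all_algebra.
From mathcomp Require Import generic_quotient.
From mathcomp Require Import all_classical reals topology normedtype zify lra.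
Set Implicit Arguments.
Unset Strict Implicit.
Unset Printing Implicit Defensive.
Import Order.TTheory GRing.Theory Num.Theory.
Import numFieldNormedType.Exports.
Local Open Scope classical_set_scope.

(* By (A1), (A2) and vertex transitivity the edges of X with equal labels form
   one Gamma-orbit, so X is the universal covering of a Salvetti complex: its
   vertices are the elements of the partially commutative group generated by
   the labels, and two reduced words lead from o to the same vertex iff they
   differ by swaps of adjacent commuting letters.
   A family of label-isomorphisms pi_v, one for each vertex v, is the family of
   local actions of an automorphism as soon as it satisfies the condition
   [compat_edge] along each edge, because this makes the relations of the group
   act consistently.  The portraits of A_(o,sigma) and A_(alpha,sigma) satisfy
   it: the latter agrees with the portrait of the conjugate of A_(o,sigma) by a
   translation from o to the endpoint y of alpha inside the intersection of the
   halfspaces of alpha, and is trivial outside; at the vertices on the boundary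
   the translated portrait still equals sigma, which fixes all labels that
   could cause a conflict.
   For density, let k fix o and act trivially around all vertices at distance
   less than n, and let |v| = n.  If alpha is the set of last letters of reduced
   words for v, the local action sigma of k at v is compatible with alpha, and
   gamma A_(alpha,sigma) gamma^-1, with gamma in Gamma mapping o to
   v alpha^-1, has local action sigma at v and acts trivially around the other
   vertices at distance at most n.  So k can be corrected at one vertex after
   the other.  Finally a compact subset of X meets the open stars of vertices at
   bounded distance only, so agreement on large balls suffices. *)

(** * Partially commutative words *)

(** With symmetry, [com_inv] makes commutation blind to inverses; with irreflexivity it keeps [x]
    and [inv x] from commuting, so no swap carries a letter past its own inverse. *)
Record commutation (T : Type) (inv : T -> T) (cm : rel T) : Prop :=
    Commutation {
  com_invK : involutive inv;
  com_irr : irreflexive cm;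
  com_sym : symmetric cm;
  com_inv : forall x y, cm (inv x) y = cm x y }.

Lemma cat_split (T : Type) (s F u u' : seq T) x : s ++ F = u ++ x :: u' ->
  (exists u2, s = u ++ x :: u2 /\ u' = u2 ++ F) \/
  (exists u1, u = s ++ u1 /\ F = u1 ++ x :: u').
Proof.
elim: s u => [|y s IH] [|z u] /=.
- by move=> ->; right; exists [::].
- by move=> ->; right; exists (z :: u).
- by move=> [-> <-]; left; exists s.
- move=> [-> /IH [[u2 [-> ->]]|[u1 [-> ->]]]]; first by left; exists u2.
  by right; exists u1.
Qed.

Section Words.
Variables (T : eqType) (inv : T -> T) (cm : rel T).
Hypothesis Hcm : commutation inv cm.
Let invK := com_invK Hcm.
Let cm_irr := com_irr Hcm.
Let cm_sym := com_sym Hcm.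
Let cm_inv := com_inv Hcm.
Local Notation prj a b := (seq.filter (pred2 a b)).
Implicit Types (a b x y : T) (u v w : seq T).

Lemma com_invr x y : cm x (inv y) = cm x y.
Proof. by rewrite cm_sym cm_inv cm_sym. Qed.

Let cm_invr := com_invr.

Let cm_xVx x : cm x (inv x) = false.
Proof. by rewrite cm_invr cm_irr. Qed.

(* Equality in the partially commutative monoid: two words are equal up to
   swaps of adjacent commuting letters iff they have the same projections to
   all pairs of noncommuting letters. *)
Definition teq u v :=
  forall a b, ~~ cm a b -> prj a b u = prj a b v.

Lemma teq_refl u : teq u u. Proof. by []. Qed.

Lemma teq_sym u v : teq u v -> teq v u.
Proof. by move=> uv a b ab; rewrite uv. Qed.

Lemma teq_trans v u w : teq u v -> teq v w -> teq u w.
Proof. by move=> uv vw a b ab; rewrite uv ?vw. Qed.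

Lemma teq_cat u u' v v' : teq u u' -> teq v v' -> teq (u ++ v) (u' ++ v').
Proof. by move=> uu vv a b ab; rewrite !filter_cat uu ?vv. Qed.

Lemma teq_cons x u v : teq u v -> teq (x :: u) (x :: v).
Proof. exact: (@teq_cat [:: x] [:: x]). Qed.

Lemma teq_cat2l w u v : teq (w ++ u) (w ++ v) -> teq u v.
Proof.
move=> uv a b /uv; rewrite !filter_cat => /eqP.
by rewrite eqseq_cat // eqxx => /eqP.
Qed.

Lemma teq_mem u v : teq u v -> u =i v.
Proof.
move=> uv x; have := uv x x;
  rewrite cm_irr => /(_ isT) /(congr1 (fun s => x \in s)).
by rewrite !mem_filter /= eqxx.
Qed.

Lemma teq_perm u v : teq u v -> perm_eq u v.
Proof.
move=> uv; apply/allP => x _; apply/eqP.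
have := uv x x; rewrite cm_irr => /(_ isT) /(congr1 size).
have xx : pred2 x x =1 pred1 x by move=> y /=; rewrite orbb.
by rewrite !size_filter !(eq_count xx).
Qed.

Lemma teq_size u v : teq u v -> size u = size v.
Proof. by move/teq_perm/perm_size. Qed.

(** A noncommuting pair containing [x] contains no letter of [u], so the projection to it does not
    see the move. *)
Lemma teq_move x u v : all (cm x) u -> teq (u ++ x :: v) (x :: u ++ v).
Proof.
move=> xu a b ab; rewrite filter_cat /= filter_cat.
case: ifP => // xab.
suff -> : prj a b u = [::] by [].
apply/eqP; rewrite -(negbK (_ == _)) -has_filter; apply/hasPn => y /(allP xu).
apply: contraL => /orP[] /eqP ->; move: xab => /= /orP[] /eqP ->.
all: by rewrite ?cm_irr // cm_sym.
Qed.

Lemma mem_split_first x v :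
  x \in v -> exists p q, v = p ++ x :: q /\ x \notin p.
Proof.
elim: v => // y v IH; have [-> _|xy] := eqVneq x y; first by exists [::], v.
rewrite inE (negPf xy) /= => /IH [p [q [-> xp]]].
by exists (y :: p), q; rewrite inE (negPf xy).
Qed.

(** Take the first [x] in [v]: the projection to [x] and a noncommuting [y] starts with [x], so no
    such [y] precedes it. *)
Lemma teq_cons_split x u v :
  teq (x :: u) v -> exists p q, v = p ++ x :: q /\ all (cm x) p.
Proof.
move=> xuv; have xv : x \in v by rewrite -(teq_mem xuv) mem_head.
have [p [q [vE xp]]] := mem_split_first xv; exists p, q; split=> //.
apply/allP => y yp; apply: contraT => xy; have := xuv x y xy.
rewrite vE filter_cat /= eqxx /=.
have : y \in prj x y p by rewrite mem_filter /= eqxx orbT.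
case E : (prj x y p) => [//|z s] _ /= [xz _];
  have : z \in prj x y p by rewrite E mem_head.
by rewrite mem_filter -xz (negPf xp) andbF.
Qed.

(** The [x] in [y :: v] that moves to the front must pass [y]; [w] is what remains of both words
    without these two letters. *)
Lemma teq_diamond x y u v : x != y -> teq (x :: u) (y :: v) ->
  cm x y /\ exists2 w, teq u (y :: w) & teq v (x :: w).
Proof.
move=> xy xuyv; have [p [q []]] := teq_cons_split xuyv.
case: p => [[yx _]|z p [<- vE] /andP[cxy xp]]; first by rewrite yx eqxx in xy.
split=> //; exists (p ++ q); last by rewrite vE; exact: teq_move.
apply: (@teq_cat2l [:: x]); apply: teq_trans xuyv _; rewrite vE.
by apply: (@teq_move x (y :: p) q); rewrite /= cxy.
Qed.

(** * Possible first letters and reduced words *)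

Definition hd x w := exists v, teq w (x :: v).

Lemma hd_teq x u v : teq u v -> hd x u -> hd x v.
Proof. by move=> /teq_sym uv [w uw]; exists w; exact: teq_trans uw. Qed.

Lemma hd_mem x w : hd x w -> x \in w.
Proof. by move=> [v /teq_mem ->]; rewrite mem_head. Qed.

Lemma hdP x w : hd x w <-> exists p q, w = p ++ x :: q /\ all (cm x) p.
Proof.
split=> [[v /teq_sym /teq_cons_split //]|[p [q [-> xp]]]].
by exists (p ++ q); exact: teq_move.
Qed.

Lemma hd_cat x u v : hd x u -> hd x (u ++ v).
Proof. by move=> [w uw]; exists (w ++ v); exact: (teq_cat uw (teq_refl v)). Qed.

Lemma hd_cons x y w : x != y -> hd x (y :: w) -> cm x y /\ hd x w.
Proof.
move=> xy [v /teq_sym /(teq_diamond xy) [? [z ? ?]]].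
by split=> //; exists z.
Qed.

Lemma hd_consr x y w : cm x y -> hd x w -> hd x (y :: w).
Proof.
move=> xy /hdP [p [q [-> xp]]]; apply/hdP; exists (y :: p), q.
by rewrite /= xy.
Qed.

Lemma hd_catr x u v : all (cm x) u -> hd x v -> hd x (u ++ v).
Proof. by elim: u => //= y u IH /andP[xy /IH{}IH] /IH; exact: hd_consr. Qed.

Fixpoint red w := if w is x :: w' then red w' /\ ~ hd (inv x) w' else True.

Lemma red_catr u v : red (u ++ v) -> red v.
Proof. by elim: u => //= x u IH [/IH]. Qed.

Lemma red_catl u v : red (u ++ v) -> red u.
Proof.
elim: u => //= x u IH [/IH ? nh]; split=> //; apply: contra_not nh.
exact: hd_cat.
Qed.

(** A letter [y] of [p] gets no new partner to cancel with, since [x] commutes with [y] and hence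
    differs from [inv y]. *)
Lemma red_insert x p q :
  red (p ++ q) -> all (cm x) p -> ~ hd (inv x) (p ++ q) -> red (p ++ x :: q).
Proof.
elim: p => [|y p IH] /=; first by [].
move=> [rpq yh] /andP[xy xp] xh; split.
  by apply: IH => //; apply: contra_not xh; apply: hd_consr; rewrite cm_inv.
move=> /(hd_teq (teq_move q xp)) /hd_cons [|_ //].
by apply: contraTneq xy => <-; rewrite cm_inv cm_irr.
Qed.

Lemma red_teq u v : teq u v -> red u -> red v.
Proof.
elim: u v => [|x u IH] v uv /=.
  by move/teq_size: uv => /esym/size0nil ->.
have [p [q [vE xp]]] := teq_cons_split uv; subst v.
have {}uv : teq u (p ++ q).
  by apply: (@teq_cat2l [:: x]); apply: teq_trans uv _; exact: teq_move.
move=> [/(IH _ uv) rpq xh]; apply: red_insert => //; apply: contra_not xh.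
exact/hd_teq/teq_sym.
Qed.

Lemma redP w : red w <->
  forall p x q r, w = p ++ x :: q ++ inv x :: r -> ~~ all (cm x) q.
Proof.
split=> [rw p x q r wE|].
  have [_ nh] : red (x :: q ++ inv x :: r) by apply: (@red_catr p); rewrite -wE.
  apply/negP => xq; apply: nh; apply/hdP; exists q, r; split=> //.
  by under eq_all do rewrite cm_inv.
elim: w => //= y w IH H; split.
  by apply: IH => p x q r wE; apply: (H (y :: p) x q r); rewrite wE.
move=> /hdP [p [q [wE yp]]]; have := H [::] y p q; rewrite wE => /(_ erefl).
by rewrite -(eq_all (cm_inv y)) yp.
Qed.

Lemma red_rev w : red w -> red (rev w).
Proof.
move=> /redP rw; apply/redP => p x q r wE.
have := rw (rev r) (inv x) (rev q) (rev p).
rewrite invK -(revK w) wE !(rev_cat, rev_cons) -!cats1 -!catA /=.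
by move=> /(_ erefl); rewrite all_rev (eq_all (cm_inv x)).
Qed.

Lemma teq_rev u v : teq u v -> teq (rev u) (rev v).
Proof. by move=> uv a b ab; rewrite !filter_rev uv. Qed.

(* Left multiplication by a letter on reduced words.  It satisfies the relations
   of the group, so that [nf] below depends on the element of the group only. *)
Definition act x w :=
  if pselect (hd (inv x) w) is left h then sval (cid h) else x :: w.

Variant act_spec x w : seq T -> Prop :=
| ActCancel v of teq w (inv x :: v) : act_spec x w v
| ActCons of ~ hd (inv x) w : act_spec x w (x :: w).

Lemma actP x w : act_spec x w (act x w).
Proof.
rewrite /act; case: pselect => [h|h]; last exact: ActCons.
by apply: ActCancel; case: cid.
Qed.

Lemma act_hd x w v : teq w (inv x :: v) -> teq (act x w) v.
Proof.
move=> wv; case: actP => [u wu|[]]; last by exists v.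
by apply: (@teq_cat2l [:: inv x]); exact: teq_trans (teq_sym wu) wv.
Qed.

Lemma act_nhd x w : ~ hd (inv x) w -> act x w = x :: w.
Proof. by case: actP => // v wv []; exists v. Qed.

Lemma act_teq x u v : teq u v -> teq (act x u) (act x v).
Proof.
move=> uv; case: actP => [w uw|h].
  by apply/teq_sym/act_hd; exact: teq_trans (teq_sym uv) uw.
rewrite act_nhd; first exact: teq_cons.
by apply: contra_not h; exact/hd_teq/teq_sym.
Qed.

Lemma act_red x w : red w -> red (act x w).
Proof. by case: actP => // v wv /(red_teq wv) []. Qed.

(** If [inv x] was cancelled, it has to be put back; by reducedness [x] is not a first letter of the
    remainder, so nothing cancels instead. *)
Lemma act_inv x w : red w -> teq (act (inv x) (act x w)) w.
Proof.
case: (actP x w) => [v wv /(red_teq wv) /= [_ ?]|_ _].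
  by rewrite act_nhd //; exact: teq_sym.
by apply: act_hd; rewrite invK.
Qed.

Lemma act_comm x y w : cm x y -> teq (act x (act y w)) (act y (act x w)).
Proof.
move=> xy; have xVyV : cm (inv x) (inv y) by rewrite cm_inv cm_invr.
have xVy : inv x != inv y.
  by apply: contraTneq xVyV => ->; rewrite cm_irr.
have nxy : inv x != y by apply: contraTneq xy => <-; rewrite cm_xVx.
have nyx : inv y != x by apply: contraTneq xy => <-; rewrite cm_sym cm_xVx.
(* If both letters cancel, the diamond gives a common remainder; if one does, the other letter moves
   past the cancelled one; if none does, the two new letters swap. *)
case: (actP y w) => [v wv|hy]; case: (actP x w) => [u wu|hx].
- have [_ [z uz vz]] := teq_diamond xVy (teq_trans (teq_sym wu) wv).
  exact: teq_trans (act_hd vz) (teq_sym (act_hd uz)).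
- rewrite act_nhd; last first.
    move=> h; apply: hx; apply: hd_teq (teq_sym wv) _.
    exact: hd_consr.
  apply/teq_sym/act_hd; apply: teq_trans (teq_cons x wv) _.
  by apply/teq_sym/(@teq_move x [:: inv y] v); rewrite /= cm_invr xy.
- rewrite [act y u]act_nhd; last first.
    move=> h; apply: hy; apply: hd_teq (teq_sym wu) _.
    by apply: hd_consr => //; rewrite cm_sym.
  apply: act_hd; apply: teq_trans (teq_cons y wu) _.
  by apply/teq_sym/(@teq_move y [:: inv x] u); rewrite /= cm_invr cm_sym xy.
- rewrite !act_nhd //.
  + by apply/teq_sym/(@teq_move x [:: y] w); rewrite /= xy.
  + by move=> /(hd_cons nyx) [].
  + by move=> /(hd_cons nxy) [].
Qed.

(** * Normal forms and equality in the partially commutative group *)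

Definition nf u := foldr act [::] u.

Lemma nf_red u : red (nf u).
Proof. by elim: u => //= x u; exact: act_red. Qed.

Lemma nf_id u : red u -> nf u = u.
Proof. by elim: u => //= x u IH [/IH -> /act_nhd]. Qed.

Lemma nf_sub (P : pred T) u : all P u -> all P (nf u).
Proof.
elim: u => //= x u IH /andP[Px /IH]; case: actP => [v uv|_ /=];
  last by rewrite Px.
by rewrite (eq_all_r (teq_mem uv)) /= => /andP[].
Qed.

Inductive weq : seq T -> seq T -> Prop :=
| weq_refl u : weq u u
| weq_sym u v : weq u v -> weq v u
| weq_trans v u w : weq u v -> weq v w -> weq u w
| weq_cancel u x v : weq (u ++ x :: inv x :: v) (u ++ v)
| weq_comm u x y v : cm x y -> weq (u ++ x :: y :: v) (u ++ y :: x :: v).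

Lemma foldr_act_teq u v w : teq v w -> teq (foldr act v u) (foldr act w u).
Proof. by elim: u => //= x u IH /IH; exact: act_teq. Qed.

Lemma weq_nf u v : weq u v -> teq (nf u) (nf v).
Proof.
elim=> {u v} [//|u v _|u v w _ uv _ vw|u x v|u x y v xy].
- exact: teq_sym.
- exact: teq_trans uv vw.
- rewrite /nf !foldr_cat; apply: foldr_act_teq => /=.
  by rewrite -{1}(invK x); apply: act_inv; exact: nf_red.
- rewrite /nf !foldr_cat; apply: foldr_act_teq => /=.
  exact: act_comm.
Qed.

(** Solves the word problem: reduced words are their own normal forms, and [act] respects the
    relations of the group. *)
Lemma red_weq u v : red u -> red v -> weq u v -> teq u v.
Proof. by move=> /nf_id {2}<- /nf_id {2}<-; exact: weq_nf. Qed.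

Lemma weq_catl w u v : weq u v -> weq (w ++ u) (w ++ v).
Proof.
elim=> {u v} [u|u v _|u v x _ uv _ vx|u x v|u x y v xy].
- exact: weq_refl.
- exact: weq_sym.
- exact: weq_trans uv vx.
- by rewrite !catA; exact: weq_cancel.
- by rewrite !catA; exact: weq_comm.
Qed.

Lemma weq_catr w u v : weq u v -> weq (u ++ w) (v ++ w).
Proof.
elim=> {u v} [u|u v _|u v x _ uv _ vx|u x v|u x y v xy].
- exact: weq_refl.
- exact: weq_sym.
- exact: weq_trans uv vx.
- by rewrite -!catA; exact: weq_cancel.
- by rewrite -!catA; exact: weq_comm.
Qed.

Definition winv u := rev (map inv u).

Lemma weq_winvr u : weq (u ++ winv u) [::].
Proof.
elim: u => [|x u IH]; first exact: weq_refl.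
rewrite /winv /= rev_cons -cats1 -/(winv u).
apply: (@weq_trans [:: x; inv x]); last exact: (@weq_cancel [::]).
by rewrite (catA u); apply: (@weq_catl [:: x]);
  exact: weq_catr [:: inv x] _ _ IH.
Qed.

Lemma weq_winvl u : weq (winv u ++ u) [::].
Proof.
have := weq_winvr (winv u); rewrite [X in _ ++ X]/winv /winv map_rev revK.
by rewrite (mapK invK).
Qed.

Lemma all_winv x u : all (cm x) (winv u) = all (cm x) u.
Proof. by rewrite /winv all_rev all_map; apply: eq_all => y /=. Qed.

Lemma teq_weq u v : teq u v -> weq u v.
Proof.
elim: u v => [|x u IH] v uv.
  by move/teq_size: uv => /esym/size0nil ->; exact: weq_refl.
have [p [q [vE xp]]] := teq_cons_split uv; subst v.
have {}uv : teq u (p ++ q).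
  by apply: (@teq_cat2l [:: x]); apply: teq_trans uv _; exact: teq_move.
apply: (@weq_trans (x :: p ++ q)); first exact: (weq_catl [:: x] (IH _ uv)).
elim: p xp {uv} => [_|y p IHp /= /andP[xy /IHp{}IHp]]; first exact: weq_refl.
apply: (@weq_trans (y :: x :: p ++ q)); first exact: (@weq_comm [::]).
exact: (weq_catl [:: y] IHp).
Qed.

Lemma nf_weq u : weq (nf u) u.
Proof.
elim: u => [|x u IH] /=; first exact: weq_refl.
apply: weq_trans (weq_catl [:: x] IH) => /=; case: actP => [v uv|_];
  last exact: weq_refl.
apply/weq_sym; apply: (@weq_trans (x :: inv x :: v)).
  exact: (weq_catl [:: x] (teq_weq uv)).
exact: (@weq_cancel [::]).
Qed.

Lemma red_rconsP u x : red u ->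
  red (rcons u x) \/ exists2 v, teq u (rcons v (inv x)) & red v.
Proof.
move=> ru; have [h|h] := pselect (hd (inv x) (rev u)).
  have [v uv] := h; right; exists (rev v).
    by rewrite -rev_cons -(revK u); exact: teq_rev.
  by apply: red_rev; have [] := red_teq uv (red_rev ru).
left; rewrite -(revK (rcons u x)); apply: red_rev.
by rewrite rev_rcons /=; split=> //; exact: red_rev.
Qed.

(** * Words of pairwise commuting letters *)

Definition clique u := uniq u && all (fun x => all (fun y =>
  (x == y) || cm x y) u) u.

Lemma clique_cons x u : clique (x :: u) -> all (cm x) u /\ clique u.
Proof.
rewrite /clique /= => /andP[/andP[xu ->] /andP[/andP[_ /allP xc] /allP cu]].
split; apply/allP => y yu.
  by have := xc y yu; case: eqVneq => // xy; rewrite xy yu in xu.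
by apply/allP => z zu; have /andP[_ /allP/(_ z zu)] := cu y yu.
Qed.

Lemma clique_perm u v : perm_eq u v -> clique u -> clique v.
Proof.
move=> uv; rewrite /clique (perm_uniq uv) -(eq_all_r (perm_mem uv)) =>
  /andP[-> /allP h].
by apply/allP => x /h; rewrite (eq_all_r (perm_mem uv)).
Qed.

Lemma clique_teq u v : clique u -> perm_eq u v -> teq u v.
Proof.
move=> /andP[uu /allP cu] uv a b ab; apply: perm_small_eq; last first.
  by rewrite perm_filter // perm_sym.
rewrite size_filter -(seq.permP uv) -size_filter.
case E : (prj a b u) => [//|x [//|y s]].
have uxy : uniq (prj a b u) by rewrite filter_uniq.
have : x \in prj a b u by rewrite E mem_head.
have : y \in prj a b u by rewrite E !inE eqxx orbT.
rewrite !mem_filter => /andP[yab yu] /andP[xab xu].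
have /allP/(_ y yu) := cu x xu; move: uxy; rewrite E /= inE negb_or -andbA.
move=> /andP[/negPf -> _] /= xy.
move: xab yab => /orP[] /eqP xE /orP[] /eqP yE; subst x y.
all: by rewrite ?cm_irr ?(cm_sym b a) ?(negPf ab) // in xy.
Qed.

Lemma clique_red u : clique u -> red u.
Proof.
elim: u => // x u IH cxu; have [/allP xc /IH ru] := clique_cons cxu.
by split=> // /hd_mem /xc; rewrite cm_xVx.
Qed.

Lemma clique_hd u w : clique u -> (forall x, x \in u -> hd x w) ->
  exists v, teq w (u ++ v).
Proof.
elim: u w => [|x u IH] w cxu hw; first by exists w.
have [/allP xc cu] := clique_cons cxu.
have [w' ww'] := hw x (mem_head _ _).
have [//|y yu|v w'v] := IH w'; last first.
  by exists v; apply: teq_trans ww' _; exact: teq_cons.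
have /(hd_teq ww') : hd y w by apply: hw; rewrite inE yu orbT.
by move=> /hd_cons [|//]; apply: contraTneq (xc y yu) => ->; rewrite cm_irr.
Qed.

Lemma red_rcons x u : red (rcons u x) -> red u /\ ~ hd (inv x) (rev u).
Proof.
move=> rux; have := red_rev rux; rewrite rev_rcons /= => -[_ ?]; split=> //.
by apply: (@red_catl u [:: x]); rewrite cats1.
Qed.

(* If [v] contains all possible last letters of [u ++ v], then a cancellation
   of [u] with [w] would have to pass through [v]. *)
Lemma red_catA u v w : red (u ++ v) -> red (v ++ w) ->
  (forall x, hd x (rev (u ++ v)) -> x \in v) -> red (u ++ v ++ w).
Proof.
move=> ruv + lastv; elim/last_ind: w => [|w x IH]; first by rewrite cats0.
rewrite -rcons_cat => /red_rcons [rvw nx]; have ruvw := IH rvw.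
(* If [x] can cancel, [inv x] is a possible last letter of [u ++ v ++ w]. It does not come from
   [v ++ w], which stays reduced with [x] appended. If it comes from [u], it is a last letter of
   [u ++ v], so it is in [v] and would have to commute with itself. *)
rewrite -rcons_cat; have [//|[z uz rz]] := red_rconsP x ruvw.
have : hd (inv x) (rev (u ++ v ++ w)).
  by exists (rev z); rewrite -rev_rcons; exact: teq_rev.
rewrite rev_cat => /hdP [p [q [E xp]]].
have [[p' [vwE _]]|[p' [pE uE]]] := cat_split E.
  by case: nx; apply/hdP; exists p, p'.
move: xp; rewrite pE rev_cat !all_cat => /andP[/andP[xw xv] xp'].
have : inv x \in v.
  apply: lastv; rewrite rev_cat; apply: hd_catr => //.
  by apply/hdP; exists p', q.
by rewrite -mem_rev => /(allP xv); rewrite cm_irr.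
Qed.

(** * Words acting step by step on a set of states *)

Section Run.
Variables (Z : Type) (step : Z -> T -> Z) (Q : Z -> Prop).
Hypothesis Q_step : forall z x, Q z -> Q (step z x).
Hypothesis step_cm :
  forall z x y, Q z -> cm x y -> step (step z x) y = step (step z y) x.

Lemma run_Q z u : Q z -> Q (foldl step z u).
Proof. by elim: u z => //= x u IH z /Q_step /IH. Qed.

Lemma run_teq z u v : Q z -> teq u v -> foldl step z u = foldl step z v.
Proof.
move=> Qz; elim: u v z Qz => [|x u IH] v z Qz uv.
  by move/teq_size: uv => /esym/size0nil ->.
have [p [q [vE xp]]] := teq_cons_split uv; subst v.
have {}uv : teq u (p ++ q).
  by apply: (@teq_cat2l [:: x]); apply: teq_trans uv _; exact: teq_move.
rewrite /= (IH (p ++ q)) //; last exact: Q_step.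
elim: p z xp Qz {uv} => //= y p IHp z /andP[xy xp] Qz.
by rewrite step_cm // IHp //; exact: Q_step.
Qed.

Hypothesis step_inv : forall z x, Q z -> step (step z x) (inv x) = z.

Lemma run_weq z u v : Q z -> weq u v -> foldl step z u = foldl step z v.
Proof.
move=> Qz; elim=> {u v} [//|u v _|u v x _ uv _ vx|u x v|u x y v xy].
- exact: esym.
- by rewrite uv.
- by rewrite !foldl_cat /= step_inv //; exact: run_Q.
- by rewrite !foldl_cat /= step_cm //; exact: run_Q.
Qed.

End Run.

End Words.

(** * Cubes and cells *)

Section Cubes.
Implicit Types m n : nat.

Lemma hdist_sum n (x y : cube n) : hdist x y = \sum_k (x k != y k).
Proof.
rewrite /hdist -sum1_card big_mkcond /=; apply: eq_bigr => k _.
by rewrite inE; case: ifP.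
Qed.

Lemma cubeflipK n (x : cube n) i : cubeflip (cubeflip x i) i = x.
Proof. by apply/ffunP=> k; rewrite !ffunE; case: (_ == _); case: (x k). Qed.

Lemma cubeflipC n (x : cube n) i j :
  cubeflip (cubeflip x i) j = cubeflip (cubeflip x j) i.
Proof. by apply/ffunP=> k; rewrite !ffunE addbCA. Qed.

Lemma hdist_flip n (x y : cube n) i :
  (hdist x (cubeflip y i) + (x i != y i) = hdist x y + (x i == y i))%N.
Proof.
rewrite !hdist_sum (bigD1 i) //= [in RHS](bigD1 i) //=.
rewrite (eq_bigr (fun k => (x k != y k) : nat)) => [|k /negPf ki].
  by rewrite ffunE eqxx; case: (x i); case: (y i) => /=; lia.
by rewrite ffunE ki.
Qed.

Lemma hdist_flip1 n (x : cube n) i : hdist x (cubeflip x i) = 1%N.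
Proof.
have := hdist_flip x x i; rewrite eqxx addn0 => ->.
by rewrite hdist_sum big1 // => k _; rewrite eqxx.
Qed.

Lemma hdist1P n (x y : cube n) : hdist x y = 1%N -> exists i, y = cubeflip x i.
Proof.
move=> /mem_card1 [i xy]; exists i; apply/ffunP => k.
by have := xy k; rewrite !inE ffunE => <-; case: (x k); case: (y k).
Qed.

Lemma cube_ind n (P : cube n -> Prop) (x0 : cube n) :
  P x0 -> (forall x i, P x -> P (cubeflip x i)) -> forall x, P x.
Proof.
move=> P0 PS x; move: {2}(hdist x0 x) (erefl (hdist x0 x)) => d.
elim: d x => [x /card0_eq x0x|d IH x dx].
  suff -> : x = x0 by [].
  by apply/ffunP => k; have := x0x k; rewrite !inE => /negbFE/eqP.
have [i] : exists i, i \in [pred k | x0 k != x k].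
  by apply/card_gt0P; rewrite -/(hdist x0 x) dx.
rewrite inE => xi; rewrite -(cubeflipK x i); apply: PS; apply: IH.
by have := hdist_flip x0 x i; rewrite xi (negPf xi) addn0 addn1 dx => -[].
Qed.

Lemma isometricP m n (f : embedding m n) x y : hdist (f x) (f y) = hdist x y.
Proof. by apply/eqP; have /forallP/(_ x)/forallP := svalP f; apply. Qed.

Lemma emb_flip m n (f : embedding m n) x i :
  exists k, f (cubeflip x i) = cubeflip (f x) k.
Proof. by apply: hdist1P; rewrite isometricP hdist_flip1. Qed.

(* An isometric map between cubes permutes and reflects the coordinates of its
   source and is constant in the remaining coordinates of its target. *)
Lemma emb_coords m n (f : embedding m n) : exists K : 'I_m -> 'I_n,
  [/\ injective K, forall x i, f x (K i) = f (cube0 m) (K i) (+) x i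
    & forall x k, k \notin codom K -> f x k = f (cube0 m) k].
Proof.
have /choice [K fK] : forall i, exists k,
  f (cubeflip (cube0 m) i) = cubeflip (f (cube0 m)) k by move=> i;
    exact: emb_flip.
have fxK x i : f x (K i) = f (cube0 m) (K i) (+) x i.
  have := hdist_flip x (cube0 m) i; rewrite ffunE.
  have := hdist_flip (f x) (f (cube0 m)) (K i); rewrite -fK !isometricP.
  by case: (f x (K i)); case: (f _ (K i)); case: (x i) => /=; lia.
have injK : injective K.
  move=> i j Kij; have := fxK (cubeflip (cube0 m) i) i.
  rewrite Kij (fxK _ j) => /(congr1 (addb (f (cube0 m) (K j)))).
  by rewrite !addKb !ffunE eqxx; case: (eqVneq j i).
(* A change outside the image of [K] would come on top of the changes in the coordinates [K i], so
   [f] would increase the distance. *)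
exists K; split=> // x k kK; apply/eqP; apply: contraT => xk.
have : (hdist x (cube0 m) < hdist (f x) (f (cube0 m)))%N.
  rewrite /hdist -(fintype.card_image injK).
  apply/proper_card/fintype.properP; split.
    apply/fintype.subsetP => _ /fintype.imageP [i xi ->].
    by move: xi; rewrite !inE fxK ffunE; case: (f _ _); case: (x i).
  exists k; first by rewrite inE.
  by apply: contra kK => /fintype.imageP [i _ ->]; exact: codom_f.
by rewrite isometricP ltnn.
Qed.

End Cubes.

(** * Square faces and reflections of a cube *)

Section CubeEmbeddings.
Variable n : nat.

Definition square_fun (x : cube n) (i j : 'I_n) : {ffun cube 2 -> cube n} :=
  [ffun b : cube 2 => [ffun k =>
    (k == i) && b i0 (+) ((k == j) && b i1) (+) x k]].

Lemma square_fun_isometric (x : cube n) i j :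
  i != j -> isometric (square_fun x i j).
Proof.
move=> ij; apply/forallP=> a; apply/forallP=> b; apply/eqP.
rewrite !hdist_sum !big_ord_recl big_ord0 addn0 (bigD1 i) //= (bigD1 j)
  1?eq_sym //=.
rewrite big1 => [|k /andP[/negPf ki /negPf kj]]; last first.
  by rewrite !ffunE ki kj eqxx.
rewrite addn0 !ffunE !eqxx (negPf ij) [j == i]eq_sym (negPf ij) /=.
rewrite -[ord0]/i0 (_ : lift i0 ord0 = i1); last exact: val_inj.
by case: (a i0); case: (b i0); case: (a i1); case: (b i1); case: (x i);
  case: (x j).
Qed.

Definition square_emb (x : cube n) i j (ij : i != j) : embedding 2 n :=
  exist (fun f => is_true (isometric f)) _ (square_fun_isometric x ij).

(** The reflection exchanging the vertices 0 and [x]; it reparametrizes a cell so that [x] becomes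
    its base vertex. *)
Definition refl_fun (x : cube n) : {ffun cube n -> cube n} :=
  [ffun y : cube n => [ffun k => y k (+) x k]].

Lemma refl_fun_isometric (x : cube n) : isometric (refl_fun x).
Proof.
apply/forallP=> a; apply/forallP=> b; apply/eqP; rewrite !hdist_sum.
by apply: eq_bigr => k _; rewrite !ffunE; case: (a k); case: (b k); case: (x k).
Qed.

Definition refl_emb (x : cube n) : embedding n n :=
  exist (fun f => is_true (isometric f)) _ (refl_fun_isometric x).

End CubeEmbeddings.

Lemma i01 : i0 != i1. Proof. by []. Qed.
Lemma i10 : i1 != i0. Proof. by []. Qed.

Lemma cube1E (b : cube 1) : b = if b ord0 then cube1 1 else cube0 1.
Proof. by apply/ffunP => i; rewrite (ord1 i); case E: (b ord0);
  rewrite ffunE. Qed.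

(** * Edges, parallelism, hyperplanes and their sides *)

Section CubeComplex.
Variable X : cubeComplex.
Implicit Types (e : X 1) (H K : set (X 1)).

Lemma vertex_face m n (f : embedding m n) (c : X n) x :
  vertex (face f c) x = vertex c (f x).
Proof.
by rewrite /vertex; apply/esym/face_comp => a /=; apply/ffunP=> k;
  rewrite /emb_fun /= !ffunE.
Qed.

Lemma edge_embE n (x : cube n) i (b : cube 1) :
  edge_emb x i b = if b ord0 then cubeflip x i else x.
Proof. by rewrite /emb_fun /= ffunE. Qed.

Lemma edge_face m n (f : embedding m n) (c : X n) x i k :
  f (cubeflip x i) = cubeflip (f x) k -> edge (face f c) x i = edge c (f x) k.
Proof.
move=> fx; rewrite /edge; apply/esym/face_comp => a /=.
by rewrite !edge_embE; case: (a ord0).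
Qed.

Lemma face_refl n (c : X n) x : face (refl_emb x) (face (refl_emb x) c) = c.
Proof.
rewrite -(face_comp (h := refl_emb (cube0 n))) ?face_id // => a.
  by apply/ffunP => k; rewrite /emb_fun /= !ffunE addbF.
by apply/ffunP => k; rewrite /emb_fun /= !ffunE addbF addbK.
Qed.

Lemma vertex_refl n (c : X n) x : vertex (face (refl_emb x) c) (cube0 n) =
  vertex c x.
Proof.
rewrite vertex_face; congr vertex; apply/ffunP => k.
by rewrite /emb_fun /= !ffunE.
Qed.

Lemma edge_refl n (c : X n) x i :
  edge (face (refl_emb x) c) (cube0 n) i = edge c x i.
Proof.
rewrite (@edge_face _ _ _ _ _ _ i).
  by congr edge; apply/ffunP => k; rewrite /emb_fun /= !ffunE.
by apply/ffunP => k; rewrite /emb_fun /= !ffunE addbF.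
Qed.

Lemma vertex0E (v : X 0) x : vertex v x = v.
Proof. by apply: face_id => a; apply/ffunP => -[]. Qed.

Lemma esrc_edge n (c : X n) x i : esrc (edge c x i) = vertex c x.
Proof.
by rewrite /esrc /edge vertex_face; congr vertex; rewrite /emb_fun /= !ffunE.
Qed.

Lemma etgt_edge n (c : X n) x i : etgt (edge c x i) = vertex c (cubeflip x i).
Proof.
by rewrite /etgt /edge vertex_face; congr vertex; rewrite /emb_fun /= !ffunE.
Qed.

Lemma edge1E e : edge e (cube0 1) ord0 = e.
Proof.
apply: face_id => a; apply/ffunP => i; rewrite (ord1 i) /emb_fun /= ffunE.
by case: (a ord0); rewrite !ffunE.
Qed.

Lemma erev_edge n (c : X n) x i : erev (edge c x i) = edge c (cubeflip x i) i.
Proof.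
have E : edge_emb x i (cube1 1) = cubeflip x i by rewrite /emb_fun /= !ffunE.
rewrite /erev {2}/edge (@edge_face _ _ _ _ _ _ i) E //.
by rewrite cubeflipK /emb_fun /= !ffunE eqxx.
Qed.

Lemma erevK e : erev (erev e) = e.
Proof. by rewrite -{1}(edge1E e) !erev_edge cubeflipK edge1E. Qed.

Lemma esrc_erev e : esrc (erev e) = etgt e.
Proof. by rewrite -{1}(edge1E e) erev_edge -{2}(edge1E e) esrc_edge etgt_edge.
  Qed.

Lemma etgt_erev e : etgt (erev e) = esrc e.
Proof. by rewrite -{2}(erevK e) esrc_erev. Qed.

Lemma edge_ofP e n (c : X n) : edge_of e c -> exists x i, e = edge c x i.
Proof.
move=> [f ->]; have [k fk] := emb_flip f (cube0 1) ord0.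
by exists (f (cube0 1)), k; rewrite -(edge1E (face f c)) (edge_face _ fk).
Qed.

Lemma edge_of_edge n (c : X n) x i : edge_of (edge c x i) c.
Proof. by exists (edge_emb x i). Qed.

Lemma square_emb_E n (x : cube n) i j (ij : i != j) :
  [/\ square_emb x ij (cube0 2) = x,
      square_emb x ij (cubeflip (cube0 2) i0) = cubeflip x i,
      square_emb x ij (cubeflip (cube0 2) i1) = cubeflip x j &
      square_emb x ij (cubeflip (cubeflip (cube0 2) i1) i0) =
        cubeflip (cubeflip x j) i].
Proof.
by split; apply/ffunP => k;
  rewrite /emb_fun /= !ffunE /= ?andbF ?andbT ?addbF ?addFb ?addbA.
Qed.

Lemma parallel_refl e : parallel e e. Proof. exact: rst_refl. Qed.

Lemma parallel_sym e e' : parallel e e' -> parallel e' e.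
Proof. exact: rst_sym. Qed.

Lemma parallel_trans e e' e'' : parallel e e' -> parallel e' e'' -> parallel e
  e''.
Proof. exact: rst_trans. Qed.

Lemma parallel_flip n (c : X n) x i j : i != j ->
  parallel (edge c x i) (edge c (cubeflip x j) i).
Proof.
move=> ij; apply: rst_step; exists (face (square_emb x ij) c).
have [E0 E1 E2 E3] := square_emb_E x ij.
by rewrite (@edge_face _ _ _ _ _ _ i) ?E0 // (@edge_face _ _ _ _ _ _ i) ?E2.
Qed.

Lemma corner_edge n (c : X n) x i j : i != j ->
  corner (edge c x i) (edge c x j).
Proof.
move=> ij; exists (face (square_emb x ij) c).
have [E0 E1 E2 E3] := square_emb_E x ij.
by rewrite (@edge_face _ _ _ _ _ _ i) ?E0 // (@edge_face _ _ _ _ _ _ j) ?E0 ?E2.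
Qed.

Lemma parallel_erev e e' : parallel e e' -> parallel (erev e) (erev e').
Proof.
elim=> {e e'} [_ _ [c [-> ->]]|e|e e' _|e e' e'' _ ee' _].
- by rewrite !erev_edge cubeflipC; exact: parallel_flip.
- exact: rst_refl.
- exact: rst_sym.
- exact: rst_trans.
Qed.

Lemma hyperplane_dual e : hyperplane (dual_hyperplane e).
Proof. by exists e. Qed.

Lemma dual_refl e : dual_hyperplane e e.
Proof. by left; exact: rst_refl. Qed.

Lemma dual_parallel e e' e'' :
  dual_hyperplane e e' -> parallel e' e'' -> dual_hyperplane e e''.
Proof.
move=> [ee'|ee'] pe; [left|right]; apply: parallel_trans ee' _ => //.
exact: parallel_erev.
Qed.

Lemma dual_erev e e' : dual_hyperplane e e' -> dual_hyperplane e (erev e').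
Proof. by move=> [ee'|ee']; [right; rewrite erevK|left]. Qed.

Lemma dual_eq e e' : dual_hyperplane e e' -> dual_hyperplane e =
  dual_hyperplane e'.
Proof.
move=> ee'; apply/seteqP; split=> f; last first.
  move=> [|/parallel_erev]; first exact: dual_parallel.
  by rewrite erevK; apply: dual_parallel; exact: dual_erev.
have [{}ee'|{}ee'] := ee'; move=> -[ef|ef].
- by left; exact: parallel_trans (parallel_sym ee') ef.
- by right; exact: parallel_trans (parallel_sym ee') ef.
- right; rewrite -(erevK e'); apply: parallel_erev.
  exact: parallel_trans (parallel_sym ee') ef.
- left; rewrite -(erevK e') -(erevK f); apply: parallel_erev.
  exact: parallel_trans (parallel_sym ee') ef.
Qed.

Lemma hyperplane_eq H e : hyperplane H -> H e -> H = dual_hyperplane e.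
Proof. by move=> [f ->]; exact: dual_eq. Qed.

Lemma hyperplane_cell H n (c : X n) x y k :
  hyperplane H -> H (edge c x k) -> H (edge c y k).
Proof.
move=> [f ->] Hx; move: y.
apply: (@cube_ind _ (fun y => dual_hyperplane f (edge c y k)) _ Hx) => y i Hy.
have [<-|ki] := eqVneq k i; first by rewrite -erev_edge; exact: dual_erev.
exact: dual_parallel Hy (parallel_flip _ _ ki).
Qed.

Lemma meetsP H n (c : X n) x : hyperplane H -> Defs.meets H c ->
  exists i, H (edge c x i).
Proof.
move=> hH [e /edge_ofP [y [i ->]] He]; exists i; exact: hyperplane_cell He.
Qed.

Lemma edge_path_cat (v w z : X 0) p q :
  edge_path v p w -> edge_path w q z -> edge_path v (p ++ q) z.
Proof. by elim: p v => /= [v ->|e p IH v [ev /IH{}IH] /IH]. Qed.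

Lemma same_side_refl H (v : X 0) : same_side H v v.
Proof. by exists [::] => // -[]. Qed.

Lemma same_side_trans H (u v w : X 0) : same_side H u v -> same_side H v w ->
  same_side H u w.
Proof.
move=> [p pp hp] [q qq hq]; exists (p ++ q); first exact: edge_path_cat qq.
suff h r : (forall p1 e p2, r = p1 ++ e :: p2 -> ~ H e) <-> (forall e, List.In
  e r -> ~ H e).
  apply/h => e /List.in_app_iff [ep|eq]; [exact: (h p).1 ep|exact: (h q).1 eq].
split=> hr.
  by move=> e er; have [p1 [p2 rE]] := List.in_split _ _ er; exact: hr rE.
by move=> p1 e p2 rE; apply: hr; rewrite rE; apply/List.in_app_iff; right; left.
Qed.

Lemma same_side_edge H e : ~ H e -> same_side H (esrc e) (etgt e).
Proof. by move=> He; exists [:: e] => // -[|? []] //= ? ? [<-]. Qed.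

Lemma same_side_cell H n (c : X n) x y :
  ~ Defs.meets H c -> same_side H (vertex c x) (vertex c y).
Proof.
move=> Hc; move: y; apply: (@cube_ind _
  (fun y => same_side H (vertex c x) (vertex c y)) x) => [|y i xy].
  exact: same_side_refl.
apply: same_side_trans xy _; rewrite -(esrc_edge c y i) -etgt_edge.
apply: same_side_edge => He; apply: Hc; exists (edge c y i) => //.
exact: edge_of_edge.
Qed.

End CubeComplex.

Section Covering.
Variables (X Y : cubeComplex) (p : cubicalMap X Y).

Lemma cmap_vertex n (c : X n) x : p 0 (vertex c x) = vertex (p n c) x.
Proof. exact: cmap_face. Qed.

Lemma cmap_edge n (c : X n) x i : p 1 (edge c x i) = edge (p n c) x i.
Proof. exact: cmap_face. Qed.

(** Unique lifting makes the covering bijective on links, so the link conditions are pulled back. *)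
Lemma covering_npc : covering p -> nonpositively_curved Y ->
  nonpositively_curved X.
Proof.
move=> [_ lift] [Ysimp Ysimpl Yflag]; split.
- move=> n c i j /(congr1 (p 1)); rewrite !cmap_edge; exact: Ysimp.
- move=> n c c' vcc' ecc'.
  have pcc' : p n c = p n c'.
    apply: Ysimpl => [|i]; first by rewrite -!cmap_vertex vcc'.
    by rewrite -!cmap_edge ecc'.
  have [d [_ dU]] := lift n (p n c') _ (cmap_vertex c' (cube0 n)).
  by rewrite -(dU c) // -(dU c').
- move=> v n e injE esv cor.
  have p_inj (e1 e2 : X 1) : esrc e1 = esrc e2 -> p 1 e1 = p 1 e2 -> e1 = e2.
    move=> s12 p12; have [d [_ dU]] := lift 1 (p 1 e1) _ (cmap_vertex e1 (cube0
      1)).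
    by rewrite -(dU e1) // -(dU e2).
  have [d [vd ed]] : exists c : Y n, vertex c (cube0 n) = p 0 v /\
      edge c (cube0 n) =1 (fun i => p 1 (e i)).
    apply: Yflag => [i j /p_inj|i|i j /cor [c [-> ->]]].
    + by rewrite !esv => /(_ erefl) /injE.
    + by rewrite /esrc -cmap_vertex -/(esrc _) esv.
    + by exists (p 2 c); rewrite !cmap_edge.
  have [c [[vc pc] _]] := lift n d v (esym vd).
  exists c; split=> // i; apply: p_inj; first by rewrite esrc_edge vc esv.
  by rewrite cmap_edge pc ed.
Qed.

End Covering.

(** * Homogeneously labelled complexes *)

Section Labelled.
Variables (X : cubeComplex) (Sigma0 : finType) (inv : Sigma0 -> Sigma0)
  (l : X 1 -> Sigma0).

(* What is left of the action of the fundamental group: all vertices have the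
   same outgoing labels, and the same pairs of labels span squares. *)
Record homogeneous : Prop := Homogeneous {
  hom_npc : nonpositively_curved X;
  hom_sc : simply_connected X;
  hom_adm : admissible_labeling inv l;
  hom_edge : forall v s, exists e, esrc e = v /\ l e = s;
  hom_square : forall v (c : X 2), exists c' : X 2,
    [/\ vertex c' (cube0 2) = v,
        l (edge c' (cube0 2) i0) = l (edge c (cube0 2) i0) &
        l (edge c' (cube0 2) i1) = l (edge c (cube0 2) i1)] }.

Hypothesis HX : homogeneous.
Let adm := hom_adm HX.
Let npc := hom_npc HX.

Lemma hom_invK : involutive inv. Proof. exact: label_invK adm. Qed.
Let invK := hom_invK.

(** Commutation read off at the corner of a parametrized square, which is easier to handle than
    [commuting]; [commutingP] identifies the two. *)
Definition label_comm s t : bool := `[< exists c : X 2,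
  l (edge c (cube0 2) i0) = s /\ l (edge c (cube0 2) i1) = t >].
Local Notation cm := label_comm.

Lemma cm_corner e e' : corner e e' -> cm (l e) (l e').
Proof. by move=> [c [-> ->]]; apply/asboolP; exists c. Qed.

Lemma cm_edge n (c : X n) x i j : i != j -> cm (l (edge c x i)) (l (edge c x
  j)).
Proof. by move=> ij; apply/cm_corner/corner_edge. Qed.

Lemma label_flip n (c : X n) x i j : i != j ->
  l (edge c (cubeflip x j) i) = l (edge c x i).
Proof. by move=> ij; apply/esym/(label_parallel adm)/parallel_flip. Qed.

Lemma label_flip_same n (c : X n) x i :
  l (edge c (cubeflip x i) i) = inv (l (edge c x i)).
Proof. by rewrite -(label_rev adm) erev_edge. Qed.

Lemma cm_irr : irreflexive cm.
Proof.
move=> s; apply/negP => /asboolP [c [c0 c1]].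
have /(link_simplex npc)  : edge c (cube0 2) i0 = edge c (cube0 2) i1.
  by apply: (label_inj adm); rewrite ?esrc_edge // c0 c1.
by [].
Qed.

Lemma cm_sym : symmetric cm.
Proof.
suff h s t : cm s t -> cm t s by move=> s t; apply/idP/idP; exact: h.
by move=> /asboolP [c [<- <-]]; exact: cm_edge.
Qed.

(** Seen from the neighbouring corner of the square, one label is inverted and the other one is
    unchanged. *)
Lemma cm_inv s t : cm (inv s) t = cm s t.
Proof.
suff h s' t' : cm s' t' -> cm (inv s') t'.
  by apply/idP/idP => /h //; rewrite invK.
move=> /asboolP [c [<- <-]];
  rewrite -label_flip_same -(label_flip c (cube0 2) i10).
exact: cm_edge.
Qed.

Lemma cm_commutation : commutation inv cm.
Proof. by split; [exact: invK|exact: cm_irr|exact: cm_sym|exact: cm_inv]. Qed.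
Let hcm := cm_commutation.

(** * Walks along labels *)

Definition edge_from v s : X 1 := sval (cid (hom_edge HX v s)).
Local Notation eg := edge_from.

Lemma eg_src v s : esrc (eg v s) = v.
Proof. by rewrite /edge_from; case: cid => e /= []. Qed.

Lemma eg_lab v s : l (eg v s) = s.
Proof. by rewrite /edge_from; case: cid => e /= []. Qed.

Lemma egE e : e = eg (esrc e) (l e).
Proof. by apply: (label_inj adm); rewrite ?eg_src ?eg_lab. Qed.

Definition step_to v s : X 0 := etgt (eg v s).
Local Notation step := step_to.

Lemma etgtE e : etgt e = step (esrc e) (l e).
Proof. by rewrite {1}(egE e). Qed.

Lemma erev_eg v s : erev (eg v s) = eg (step v s) (inv s).
Proof. by rewrite (egE (erev _)) esrc_erev (label_rev adm) eg_lab. Qed.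

Lemma vertex_flip n (c : X n) x i :
  vertex c (cubeflip x i) = step (vertex c x) (l (edge c x i)).
Proof. by rewrite -etgt_edge etgtE esrc_edge. Qed.

Lemma step_inv v s : step (step v s) (inv s) = v.
Proof. by rewrite /step_to -/(step v s) -erev_eg etgt_erev eg_src. Qed.

Lemma square_ex v s t : cm s t -> exists c : X 2,
  [/\ vertex c (cube0 2) = v, l (edge c (cube0 2) i0) = s &
      l (edge c (cube0 2) i1) = t].
Proof. by move=> /asboolP [c [<- <-]]; exact: (hom_square HX). Qed.

Lemma corner_eg v s t : cm s t -> corner (eg v s) (eg v t).
Proof.
move=> /(square_ex v) [c [vc cs ct]]; exists c.
by split; apply: (label_inj adm); rewrite ?eg_src ?eg_lab ?esrc_edge.
Qed.

Lemma step_cm v s t : cm s t -> step (step v s) t = step (step v t) s.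
Proof.
move=> /(square_ex v) [c [<- <- <-]].
rewrite -!vertex_flip -(label_flip c (cube0 2) i10) -vertex_flip cubeflipC
  vertex_flip.
by rewrite (label_flip _ _ i01).
Qed.

Lemma parallel_eg v s t : cm s t -> parallel (eg v s) (eg (step v t) s).
Proof.
move=> /(square_ex v) [c [vc cs ct]].
have := parallel_flip c (cube0 2) i01.
rewrite (egE (edge _ _ _)) (egE (edge _ (cubeflip _ _) _)) !esrc_edge.
by rewrite (label_flip _ _ i01) vertex_flip vc cs ct.
Qed.

Definition endpoint v u := foldl step v u.
Local Notation run := endpoint.

Lemma run_cat v u u' : run v (u ++ u') = run (run v u) u'.
Proof. exact: foldl_cat. Qed.

Lemma run_rcons v u s : run v (rcons u s) = step (run v u) s.
Proof. exact: foldl_rcons. Qed.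

Lemma parallel_run v s u : all (cm s) u -> parallel (eg v s) (eg (run v u) s).
Proof.
elim: u v => [|t u IH] v /=; first by move=> _; exact: parallel_refl.
by move=> /andP[/(parallel_eg v) st /(IH (step v t))]; exact: parallel_trans.
Qed.

(** An elementary parallelism translates an edge across a square, along a letter that commutes with
    its label. *)
Lemma parallelP e e' : parallel e e' ->
  l e = l e' /\ exists2 u, all (cm (l e)) u & esrc e' = run (esrc e) u.
Proof.
elim=> {e e'} [_ _ [c [-> ->]]|e|e e' _ [ee' [u eu ->]]|e e' e'' _ [ee' [u eu
  ve]] _ [e'e'' [u' eu' ->]]].
- rewrite (label_flip _ _ i01); split=> //.
  exists [:: l (edge c (cube0 2) i1)]; first by rewrite /= andbT cm_edge.
  by rewrite /= !esrc_edge vertex_flip.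
- by split=> //; exists [::].
- split=> //; exists (winv inv u); first by rewrite (all_winv hcm) -ee'.
  elim: u {eu} (esrc e) => //= s u IH v.
  rewrite /winv /= rev_cons -/(winv inv u) run_rcons.
  by rewrite -IH step_inv.
- by rewrite ee'; split=> //; exists (u ++ u');
  rewrite ?run_cat ?ve // all_cat -{1}ee' eu.
Qed.

Lemma run_step v s u : all (cm s) u -> run (step v s) u = step (run v u) s.
Proof.
elim: u v => //= t u IH v /andP[st su].
by rewrite (step_cm _ st) IH.
Qed.

(** In terms of words a hyperplane is a coset of the subgroup generated by the letters commuting
    with [s]; the two cases are the orientations of its edges. *)
Lemma dualP v s e : dual_hyperplane (eg v s) e -> exists2 u, all (cm s) u &
  e = eg (run v u) s \/ e = eg (run v (s :: u)) (inv s).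
Proof.
move=> [/parallelP|/parallelP]; rewrite eg_lab eg_src.
  by move=> [sE [u su ve]]; exists u => //; left; rewrite (egE e) -sE ve.
move=> [sE [u su ve]]; exists u => //; right.
have {ve} : erev e = eg (run v u) s by rewrite (egE (erev e)) -sE ve.
move/(congr1 (@erev X)); rewrite erevK erev_eg => ->; congr (eg _ _).
by rewrite /= run_step.
Qed.

Lemma dual_run v s u : all (cm s) u ->
  dual_hyperplane (eg v s) (eg (run v u) s).
Proof. by left; exact: parallel_run. Qed.

Lemma edge_path_run (v w : X 0) q : edge_path v q w -> w = run v (map l q).
Proof.
elim: q v => /= [v ->|e q IH v [<- /IH ->]] //.
by rewrite etgtE.
Qed.

Fixpoint path_of v u : seq (X 1) :=
  if u is s :: u' then eg v s :: path_of (step v s) u' else [::].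

Lemma path_ofP v u : edge_path v (path_of v u) (run v u).
Proof. by elim: u v => //= s u IH v; rewrite eg_src. Qed.

Lemma path_of_label v u : map l (path_of v u) = u.
Proof. by elim: u v => //= s u IH v; rewrite eg_lab IH. Qed.

Local Notation weq := (weq inv cm).

(** The two homotopy moves are the two kinds of relations: a backtrack is a cancelling pair, a
    square swaps commuting letters. *)
Lemma homotopic_weq (v w : X 0) q q' :
  homotopic v w q q' -> weq (map l q) (map l q').
Proof.
elim=> {q q'} [_ _ []|q|q q' _|q q' q'' _ + _] .
- move=> q e q' _ _; rewrite !map_cat /= (label_rev adm).
  exact/weq_sym/weq_cancel.
- move=> q c q' _ _; rewrite !map_cat /= (label_flip _ _ i01) (label_flip _ _
  i10).
  exact/weq_comm/cm_edge.
- exact: weq_refl.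
- exact: weq_sym.
- exact: weq_trans.
Qed.

Lemma weq_run v u u' : weq u u' -> run v u = run v u'.
Proof.
apply: (@run_weq _ _ _ _ step (fun=> True)) => // *; first exact: step_cm.
exact: step_inv.
Qed.

(** Identifies the vertices with the elements of the group: two words with the same endpoint form a
    loop, which is null-homotopic by simple connectedness. *)
Lemma run_eq v u u' : run v u = run v u' <-> weq u u'.
Proof.
split=> [vu|]; last exact: weq_run.
have vuu' : run v (u ++ winv inv u') = v.
  rewrite run_cat vu -run_cat (@weq_run _ _ [::]) //.
  exact: weq_winvr.
have /homotopic_weq : homotopic v v (path_of v (u ++ winv inv u')) [::].
  by apply: (hom_sc HX).2; rewrite -{3}vuu'; exact: path_ofP.
rewrite path_of_label => /(weq_catr u'); rewrite -catA; apply: weq_trans.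
apply: weq_sym; rewrite -{2}(cats0 u); apply: weq_catl.
exact: weq_winvl hcm _.
Qed.

Lemma connected_run o v : exists u, run o u = v.
Proof.
by have [q /edge_path_run ->] := (hom_sc HX).1 o v; exists (map l q).
Qed.

Definition geodesic o v := nf inv cm (sval (cid (connected_run o v))).
Local Notation N := geodesic.

Lemma run_nf v u : run v (nf inv cm u) = run v u.
Proof. exact/run_eq/nf_weq. Qed.

Lemma run_N o v : run o (N o v) = v.
Proof. by rewrite /geodesic; case: cid => u /= <-; exact: run_nf. Qed.

Lemma N_red o v : red inv cm (N o v).
Proof. exact: nf_red. Qed.

Lemma red_teq_run v u u' : red inv cm u -> red inv cm u' ->
  run v u = run v u' -> teq cm u u'.
Proof.
by move=> ru ru' /run_eq; exact: (red_weq hcm).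
Qed.

Lemma N_teq o u : red inv cm u -> teq cm (N o (run o u)) u.
Proof. by move=> ru; apply: (@red_teq_run o) => //;
  [exact: N_red|rewrite run_N]. Qed.

Lemma cell_ex v n (t : 'I_n -> Sigma0) :
  (forall i j, i != j -> cm (t i) (t j)) ->
  exists c : X n, vertex c (cube0 n) = v /\ forall i, l (edge c (cube0 n) i) =
    t i.
Proof.
move=> ct; have [|i|i j ij|c [vc ec]] := @link_flag _ npc v n (fun i =>
  eg v (t i)).
- move=> i j /(congr1 l); rewrite !eg_lab => tij; apply/eqP.
  by apply: contraT => /ct; rewrite tij cm_irr.
- exact: eg_src.
- exact/corner_eg/ct.
- by exists c; split=> // i; rewrite ec eg_lab.
Qed.

Lemma cell_eq n (c c' : X n) : vertex c (cube0 n) = vertex c' (cube0 n) ->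
  (forall i, l (edge c (cube0 n) i) = l (edge c' (cube0 n) i)) -> c = c'.
Proof.
move=> vcc' lcc'; apply: (link_simplicial npc) => // i.
by apply: (label_inj adm); rewrite ?esrc_edge.
Qed.

Lemma vertex_run n (c : X n) x js : uniq js ->
  vertex c (foldl (@cubeflip n) x js) =
  run (vertex c x) [seq l (edge c x j) | j <- js].
Proof.
elim: js x => //= j js IH x /andP[jjs ujs].
rewrite IH // vertex_flip; congr (run _ _); apply/eq_in_map => k kjs.
by rewrite label_flip //; apply: contraNneq jjs => <-.
Qed.

Lemma flipsE n (x : cube n) js k : uniq js ->
  foldl (@cubeflip n) x js k = (k \in js) (+) x k.
Proof.
elim: js x => //= j js IH x /andP[jjs ujs].
rewrite IH // ffunE in_cons; case: eqVneq => [->|//].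
by rewrite (negPf jjs).
Qed.

Lemma clique_labels n (c : X n) x js : uniq js ->
  clique cm [seq l (edge c x j) | j <- js].
Proof.
move=> ujs; rewrite /clique map_inj_uniq ?ujs => [/=|i j lij].
  apply/allP => _ /mapP [i _ ->]; apply/allP => _ /mapP [j _ ->].
  by have [->|/(cm_edge c x) ->] := eqVneq i j; rewrite ?eqxx ?orbT.
by apply/eqP; apply: contraT => /(cm_edge c x); rewrite lij cm_irr.
Qed.

Lemma run_neq v u : red inv cm u -> u <> [::] -> run v u <> v.
Proof.
move=> ru u0 vu; have := @red_teq_run v u [::] ru I vu.
by move/(teq_size hcm)/size0nil.
Qed.

(** The labels of the coordinates in which [x] and [y] differ form a clique, hence a reduced word; a
    loop forces it to be empty. *)
Lemma vertex_inj n (c : X n) : injective (vertex c).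
Proof.
move=> x y xy; pose js := [seq k <- enum 'I_n | x k != y k].
have ujs : uniq js by rewrite filter_uniq // enum_uniq.
have yE : foldl (@cubeflip n) x js = y.
  apply/ffunP => k; rewrite flipsE // mem_filter mem_enum andbT.
  by case: (x k); case: (y k).
have js0 : js = [::].
  case E : js => [//|j js'].
  exfalso; apply: (@run_neq (vertex c x) [seq l (edge c x j) | j <- js]).
  - exact/(clique_red hcm)/clique_labels.
  - by rewrite E.
  - by rewrite -vertex_run // yE.
by rewrite -yE js0.
Qed.

Lemma vertex_of1 (v : X 0) (e : X 1) : vertex_of v e -> v = esrc e \/ v = etgt
  e.
Proof. by move=> [x ->]; rewrite (cube1E x); case: (x ord0); [right|left]. Qed.

(** [span_square] allows any position of the edges in the square. Injectivity on vertices puts them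
    at one corner, and equal directions would make them coincide and share two endpoints. *)
Lemma commutingP s t : commuting l s t <-> cm s t.
Proof.
split.
  move=> [e [e' [see <- <-]]] [[v [_ vU]]] [c [ec e'c]].
  have [y [i eE]] := edge_ofP ec; have [y' [j e'E]] := edge_ofP e'c.
  move: see; rewrite eE e'E !esrc_edge => /vertex_inj yy'; subst y'.
  have [ij|/cm_edge -> //] := eqVneq i j; exfalso.
  have ee' : e' = e by rewrite eE e'E ij.
  rewrite ee' in vU; have sv : v = esrc e by apply: vU; split; exists (cube0 1).
  have tv : v = etgt e by apply: vU; split; exists (cube1 1).
  move: tv; rewrite sv eE esrc_edge etgt_edge => /vertex_inj /ffunP /(_ i).
  by rewrite ffunE eqxx; case: (y i).
move=> cst; have [o] : inhabited (X 0).
  by have /asboolP [c _] := cst; exists; exact: vertex c (cube0 2).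
exists (eg o s), (eg o t); rewrite !eg_src !eg_lab; split=> //.
have [c [-> ->]] := corner_eg o cst; split; last first.
  by exists c; split; exact: edge_of_edge.
exists (vertex c (cube0 2)); split.
  by split; exists (cube0 1); rewrite -/(esrc _) esrc_edge.
move=> v [/vertex_of1 + /vertex_of1]; rewrite !esrc_edge !etgt_edge.
move=> [//|->] [//|/vertex_inj /ffunP /(_ i0)].
by rewrite !ffunE.
Qed.

End Labelled.

(** * Automorphisms with a given portrait *)

Section Portraits.
Variables (X : cubeComplex) (Sigma0 : finType) (inv : Sigma0 -> Sigma0)
  (l : X 1 -> Sigma0).
Hypothesis HX : homogeneous inv l.
Let invK := hom_invK HX.
Let hcm := cm_commutation HX.
Local Notation cm := (label_comm l).
Local Notation step := (step_to HX).
Local Notation run := (endpoint HX).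
Local Notation N := (geodesic HX).
Implicit Types (s t : Sigma0) (sigma : {perm Sigma0}) (pi : X 0 -> {perm
  Sigma0}).

Definition label_iso sigma := forall s t, cm (sigma s) (sigma t) = cm s t.

Lemma label_isoP sigma : label_isomorphism l sigma <-> label_iso sigma.
Proof.
split=> h s t.
  apply/idP/idP => /(commutingP HX) st; apply/(commutingP HX).
    exact/(h s t).
  exact/(h s t).1.
by rewrite !(commutingP HX) h.
Qed.

(* The consistency conditions under which the local actions [pi v] are induced
   by an automorphism. *)
Definition compat_edge pi v s :=
  pi (step v s) (inv s) = inv (pi v s) /\
  forall t, cm s t -> pi (step v s) t = pi v t.

Definition portrait pi :=
  (forall v s, compat_edge pi v s) /\ (forall v, label_iso (pi v)).

Lemma compat_edge_sym pi v s :
  compat_edge pi v s -> compat_edge pi (step v s) (inv s).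
Proof.
move=> [p1 p2]; split; rewrite step_inv.
  by rewrite p1 !invK.
by move=> t; rewrite (com_inv hcm) => /p2.
Qed.

(** * Extending a map of vertices with given local actions to all cells *)

Section Extend.
Variables (phi : X 0 -> X 0) (pi : X 0 -> {perm Sigma0}).
Hypothesis phi_step : forall v s, phi (step v s) = step (phi v) (pi v s).
Hypothesis pi_portrait : portrait pi.

Lemma extend_ex n (c : X n) : exists c' : X n,
  vertex c' (cube0 n) = phi (vertex c (cube0 n)) /\
  forall i, l (edge c' (cube0 n) i) = pi (vertex c (cube0 n)) (l (edge c (cube0
    n) i)).
Proof.
by apply: (cell_ex HX) => i j ij; rewrite pi_portrait.2; exact: cm_edge.
Qed.

Definition extend n (c : X n) : X n := sval (cid (extend_ex c)).

(** The image cell is chosen at the vertex 0 only; [compat_edge] transports its description along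
    the edges of the cube. *)
Lemma extendP n (c : X n) x :
  vertex (extend c) x = phi (vertex c x) /\
  forall k, l (edge (extend c) x k) = pi (vertex c x) (l (edge c x k)).
Proof.
move: x; apply: (@cube_ind _ _ (cube0 n)).
  by rewrite /extend; case: cid.
move=> x i [vx lx]; split; first by rewrite !(vertex_flip HX) vx lx phi_step.
move=> k; rewrite (vertex_flip HX);
  have [p1 p2] := pi_portrait.1 (vertex c x) (l (edge c x i)).
have [->|ki] := eqVneq k i; first by rewrite !(label_flip_same HX) lx p1.
by rewrite !(label_flip HX) // lx p2 // (cm_edge _ _ _) // eq_sym.
Qed.

Lemma extend_face m n (f : embedding m n) (c : X n) :
  extend (face f c) = face f (extend c).
Proof.
have [v0 l0] := extendP (face f c) (cube0 m).
apply: (cell_eq HX); first by rewrite v0 !vertex_face (extendP c _).1.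
move=> i; rewrite l0; have [k fk] := emb_flip f (cube0 m) i.
by rewrite !(edge_face _ fk) vertex_face (extendP c _).2.
Qed.

Lemma extend0 v : extend v = phi v :> X 0.
Proof. by rewrite -{1}(vertex0E (extend v) (cube0 0)) (extendP v _).1 vertex0E.
  Qed.

Lemma extend1 e : l (extend e) = pi (esrc e) (l e).
Proof.
by have [_ /(_ ord0)] := extendP e (cube0 1); rewrite !edge1E.
Qed.

End Extend.

(** * The automorphism with a given portrait *)

Section Realize.
Variables (o : X 0) (pi : X 0 -> {perm Sigma0}).
Hypothesis pi_portrait : portrait pi.

(** States for reading a word from [o]: the current vertex together with its image ([fwd]) or
    preimage ([bwd]) under the automorphism to be built. *)
Let fwd (z : X 0 * X 0) s := (step z.1 s, step z.2 (pi z.1 s)).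
Let bwd (z : X 0 * X 0) s := (step z.1 s, step z.2 ((pi z.2)^-1%g s)).
Let phi v := (foldl fwd (o, o) (N o v)).2.
Let psi v := (foldl bwd (o, o) (N o v)).2.

Let fwd_weq u u' : weq inv cm u u' -> foldl fwd (o, o) u = foldl fwd (o, o) u'.
Proof.
apply: (@run_weq _ _ _ _ fwd (fun=> True)) => // -[v x].
  move=> s t _ st; rewrite /fwd /= ((pi_portrait.1 v s).2 _ st).
  have ts : cm t s by rewrite (com_sym hcm).
  rewrite ((pi_portrait.1 v t).2 _ ts) (step_cm HX v st) (step_cm HX x) //.
  by rewrite pi_portrait.2.
move=> s _; rewrite /fwd /= (pi_portrait.1 v s).1.
by rewrite !step_inv.
Qed.

Let bwd_inv v s : pi (step v ((pi v)^-1%g s)) (inv ((pi v)^-1%g s)) = inv s.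
Proof. by rewrite (pi_portrait.1 _ _).1 permKV. Qed.

Let bwd_cm v s t : cm s t ->
  pi (step v ((pi v)^-1%g s)) ((pi v)^-1%g t) = t.
Proof.
move=> st; rewrite (pi_portrait.1 _ _).2 ?permKV //.
by rewrite -(pi_portrait.2 v) !permKV.
Qed.

Let bwd_weq u u' : weq inv cm u u' -> foldl bwd (o, o) u = foldl bwd (o, o) u'.
Proof.
apply: (@run_weq _ _ _ _ bwd (fun=> True)) => // -[x v].
  move=> s t _ st; have ts : cm t s by rewrite (com_sym hcm).
  rewrite /bwd /= (step_cm _ x) //; congr (_, _).
  rewrite (_ : (pi (step v ((pi v)^-1%g s)))^-1%g t = (pi v)^-1%g t);
    last first.
    by rewrite -{1}(bwd_cm v st) permK.
  rewrite (_ : (pi (step v ((pi v)^-1%g t)))^-1%g s = (pi v)^-1%g s);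
    last first.
    by rewrite -{1}(bwd_cm v ts) permK.
  by rewrite (step_cm HX) // -(pi_portrait.2 v) !permKV.
by move=> s _; rewrite /bwd /= -{2}(bwd_inv v s) permK !step_inv.
Qed.

Let fst_fwd u : (foldl fwd (o, o) u).1 = run o u.
Proof. by elim/last_ind: u => // u s IH;
  rewrite foldl_rcons run_rcons /= IH. Qed.

Let N_weq u : weq inv cm (N o (run o u)) u.
Proof. by apply/(run_eq HX o); rewrite run_N. Qed.

Let phi_run u : phi (run o u) = (foldl fwd (o, o) u).2.
Proof. by rewrite /phi (fwd_weq (N_weq u)). Qed.

Let psi_run u : psi (run o u) = (foldl bwd (o, o) u).2.
Proof. by rewrite /psi (bwd_weq (N_weq u)). Qed.

Let phi_step v s : phi (step v s) = step (phi v) (pi v s).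
Proof.
by rewrite -(run_N HX o v) -run_rcons !phi_run foldl_rcons /= fst_fwd.
Qed.

Let psi_step v s : psi (step v s) = step (psi v) ((pi (psi v))^-1%g s).
Proof.
by rewrite -(run_N HX o v) -run_rcons !psi_run foldl_rcons.
Qed.

Let phio : phi o = o. Proof. exact: (phi_run [::]). Qed.
Let psio : psi o = o. Proof. exact: (psi_run [::]). Qed.

Let phiK : cancel phi psi.
Proof.
move=> v; rewrite -(run_N HX o v); elim/last_ind: (N o v) => [|u s IH].
  by rewrite /= phio psio.
by rewrite run_rcons phi_step psi_step IH permK.
Qed.

Let psiK : cancel psi phi.
Proof.
move=> v; rewrite -(run_N HX o v); elim/last_ind: (N o v) => [|u s IH].
  by rewrite /= psio phio.
by rewrite run_rcons psi_step phi_step IH permKV.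
Qed.

(** The portrait of the inverse: it undoes at [v] the action at the preimage of [v]. *)
Let pi' v : {perm Sigma0} := ((pi (psi v))^-1)%g.

Let pi'_portrait : portrait pi'.
Proof.
split=> [v s|v s t]; last by rewrite /pi' -(pi_portrait.2 (psi v)) !permKV.
rewrite /compat_edge /pi' psi_step; split.
  by apply: (@perm_inj _ (pi (step (psi v) ((pi (psi v))^-1%g s))));
    rewrite permKV bwd_inv.
by move=> t st; apply: (@perm_inj _ (pi (step (psi v) ((pi (psi v))^-1%g s))));
  rewrite permKV bwd_cm.
Qed.

Lemma portrait_aut : exists g : aut X,
  g 0 o = o /\ forall e, l (g 1 e) = pi (esrc e) (l e).
Proof.
pose G := extend phi pi_portrait.
pose G' := extend psi pi'_portrait.
have GK n : cancel (G n) (G' n).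
  move=> c; have [v0 l0] := extendP psi_step pi'_portrait (G n c) (cube0 n).
  have [v1 l1] := extendP phi_step pi_portrait c (cube0 n).
  apply: (cell_eq HX) => [|i]; first by rewrite v0 v1 phiK.
  by rewrite l0 l1 v1 /pi' phiK permK.
have G'K n : cancel (G' n) (G n).
  move=> c; have [v0 l0] := extendP phi_step pi_portrait (G' n c) (cube0 n).
  have [v1 l1] := extendP psi_step pi'_portrait c (cube0 n).
  apply: (cell_eq HX) => [|i]; first by rewrite v0 v1 psiK.
  by rewrite l0 l1 v1 permKV.
exists (@Aut X G G' (@extend_face _ _ phi_step pi_portrait) GK G'K).
split=> [|e] /=; first by rewrite -[RHS]phio; exact: extend0.
exact: (extend1 phi_step).
Qed.

End Realize.

(** * The operation tau for single letters *)

Section Root.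

(** One factor of [tau]: the swap enforces the first condition of [compat_edge] ([tau1_inv]) and
    does not disturb the second ([tau1_cm]). *)
Definition tau_letter sigma s : {perm Sigma0} :=
  (sigma * tperm (sigma (inv s)) (inv (sigma s)))%g.
Local Notation tau1 := tau_letter.

Lemma tau1_inv sigma s : tau1 sigma s (inv s) = inv (sigma s).
Proof. by rewrite permM tpermL. Qed.

(** Both letters commute with [t] iff [s] commutes with the preimage of [t]; this is why swapping
    them preserves commutation. *)
Lemma label_iso_inv sigma s t : label_iso sigma ->
  cm (sigma (inv s)) t = cm (inv (sigma s)) t.
Proof.
by move=> h; rewrite -(permKV sigma t) h !(com_inv hcm) h.
Qed.

Lemma tau1_cm sigma s t : label_iso sigma -> cm s t -> tau1 sigma s t = sigma t.
Proof.
move=> h st; rewrite permM tpermD //.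
  by rewrite (inj_eq perm_inj); apply: contraTneq st => <-;
    rewrite (com_sym hcm) (com_inv hcm) (com_irr hcm).
apply: contraTneq st => st; rewrite -h -st (com_sym hcm) (com_inv hcm).
by rewrite (com_irr hcm).
Qed.

Lemma tau1_iso sigma s : label_iso sigma -> label_iso (tau1 sigma s).
Proof.
move=> h t t'; rewrite !permM -(h t t').
have sym := com_sym hcm.
have tw x : cm (sigma (inv s)) x = cm (inv (sigma s)) x by exact: label_iso_inv.
move: (sigma (inv s)) (inv (sigma s)) tw (sigma t) (sigma t') => a b tw x y.
have twr z : cm z a = cm z b by rewrite sym tw sym.
by case: tpermP => [->|->|_ _]; case: tpermP => [->|->|_ _];
  rewrite ?tw ?twr ?tw ?twr.
Qed.

(** The transpositions are disjoint: every letter moved by one commutes with every letter moved by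
    the other, hence differs from it. *)
Lemma tau1_comm sigma s t : label_iso sigma -> cm s t ->
  tau1 (tau1 sigma s) t = tau1 (tau1 sigma t) s.
Proof.
move=> h st; have ts : cm t s by rewrite (com_sym hcm).
rewrite {1}/tau_letter [in RHS]/tau_letter !tau1_cm // ?(com_invr hcm) //.
rewrite /tau_letter -!mulgA; congr (_ * _)%g; rewrite conjgC tpermJ.
have ne x y : cm x y -> y != x by apply: contraTneq => ->;
  rewrite (com_irr hcm).
by congr (_ * tperm _ _)%g; rewrite tpermD // ne //
  ?(label_iso_inv, com_sym hcm _ (sigma (inv _))) ?(com_inv hcm) //
  ?(label_iso_inv, com_sym hcm _ (sigma _)) ?(com_inv hcm) // ?(com_invr hcm) h
    ?(com_invr hcm).
Qed.

End Root.
End Portraits.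

Lemma flatten_map_split (A T : Type) (f : A -> seq T) w u x u' :
  flatten (map f w) = u ++ x :: u' ->
  exists w1 b w2 u1 u2, [/\ w = w1 ++ b :: w2, f b = u1 ++ x :: u2,
    u = flatten (map f w1) ++ u1 & u' = u2 ++ flatten (map f w2)].
Proof.
elim: w u => [|b w IH] u /=; first by case: u.
move=> h; have [[u2 [bE ->]]|[u1 [-> /IH]]] := cat_split h.
  by exists [::], b, w, u, u2.
move=> [w1 [c [w2 [u2 [u3 [-> cE -> ->]]]]]].
by exists (b :: w1), c, w2, u2, u3; rewrite /= catA.
Qed.

(** * Portraits along words and flattened cube paths *)

Section Roots.
Variables (X : cubeComplex) (Sigma0 : finType) (inv : Sigma0 -> Sigma0)
  (l : X 1 -> Sigma0).
Hypothesis HX : homogeneous inv l.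
Let invK := hom_invK HX.
Let hcm := cm_commutation HX.
Local Notation cm := (label_comm l).
Local Notation step := (step_to HX).
Local Notation run := (endpoint HX).
Local Notation N := (geodesic HX).
Local Notation eg := (edge_from HX).
Local Notation label_iso := (@label_iso X Sigma0 l).
Local Notation tau1 := (tau_letter inv).
Implicit Types (s t : Sigma0) (sigma : {perm Sigma0}) (pi : X 0 -> {perm
  Sigma0})
  (a b : {set Sigma0}) (u : seq Sigma0).

Definition tau_letters sigma u : {perm Sigma0} := foldl tau1 sigma u.
Local Notation taus := tau_letters.

Lemma taus_cat sigma u u' : taus sigma (u ++ u') = taus (taus sigma u) u'.
Proof. exact: foldl_cat. Qed.

Lemma taus_iso sigma u : label_iso sigma -> label_iso (taus sigma u).
Proof. by apply: run_Q => pi s; exact: tau1_iso. Qed.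

Lemma taus_teq sigma u u' : label_iso sigma -> teq cm u u' ->
  taus sigma u = taus sigma u'.
Proof.
apply: (@run_teq _ inv _ hcm _ tau1 label_iso) => [pi s|pi s t].
  exact: tau1_iso.
by move=> hpi st; exact: (tau1_comm HX).
Qed.

Lemma taus_fix sigma u :
  (forall s, s \in u -> sigma s = s /\ sigma (inv s) = inv s) ->
  taus sigma u = sigma.
Proof.
elim: u => // s u IH h; rewrite /tau_letters /= (_ : tau1 sigma s = sigma).
  by apply: IH => t tu; apply: h; rewrite inE tu orbT.
by have [ss sVs] := h s (mem_head _ _); rewrite /tau_letter ss sVs tperm1 mulg1.
Qed.

Lemma taus_clique sigma u : label_iso sigma -> clique cm u ->
  taus sigma u = (sigma * \prod_(s <- u) tperm (sigma (inv s)) (inv (sigma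
    s)))%g.
Proof.
elim: u sigma => [|s u IH] sigma hs; first by rewrite big_nil mulg1.
move=> csu; have [/allP sc cu] := clique_cons csu.
rewrite /tau_letters /= -/(tau_letters _ _) IH ?big_cons //;
  last exact: tau1_iso.
rewrite /tau_letter -mulgA; congr (_ * (_ * _))%g; apply: eq_big_seq => t tu.
have st := sc t tu.
by rewrite -!/(tau_letter inv sigma s) !(tau1_cm HX) // (com_invr hcm).
Qed.

Lemma tauE sigma b : label_iso sigma -> clique cm (enum b) ->
  tau inv sigma b = taus sigma (enum b).
Proof.
move=> hs cb; rewrite taus_clique // /tau; congr (_ * _)%g.
by rewrite -big_filter /index_enum; case: index_enum_key.
Qed.

Lemma clique_enum b :
  {in b &, forall s t, s != t -> commuting l s t} -> clique cm (enum b).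
Proof.
move=> cb; rewrite /clique enum_uniq; apply/allP => s; rewrite mem_enum => sb.
apply/allP => t; rewrite mem_enum => tb; case: eqVneq => //= st.
exact/(commutingP HX)/cb.
Qed.

(** For [y = o] the portrait of A_(o,sigma), read letter by letter; in general its translate to the
    base point [y]. For a label-isomorphism the choice of the reduced word is immaterial by
    [taus_teq]. *)
Definition root_portrait y sigma z := taus sigma (N y z).

Lemma root_portraitE y sigma u : label_iso sigma -> red inv cm u ->
  root_portrait y sigma (run y u) = taus sigma u.
Proof. by move=> hs ru; apply: taus_teq => //; exact: N_teq. Qed.

Lemma compat_edge_tau1 pi v s : label_iso (pi v) ->
  pi (step v s) = tau1 (pi v) s -> compat_edge HX pi v s.
Proof.
by move=> hv pE; split=> [|t st]; rewrite pE ?tau1_inv ?(tau1_cm HX).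
Qed.

(** At the end of an edge that is farther from [y] the action is [tau_letter] of the one at the
    nearer end; an edge pointing towards [y] is reversed first. *)
Lemma root_portraitP y sigma : label_iso sigma ->
  portrait HX (root_portrait y sigma).
Proof.
move=> hs; have iso z : label_iso (root_portrait y sigma z) by exact: taus_iso.
split=> // v s.
have [rs|[u uv ru]] := red_rconsP hcm s (N_red HX y v).
  apply: compat_edge_tau1 => //.
  rewrite -[v in step v s](run_N HX y) -run_rcons root_portraitE //.
  by rewrite /tau_letters foldl_rcons.
have vE : v = run y (rcons u (inv s)).
  by rewrite -{1}(run_N HX y v); exact/weq_run/(teq_weq hcm).
have us : step v s = run y u.
  by have := step_inv HX (run y u) (inv s); rewrite invK -run_rcons -vE.
have := @compat_edge_sym _ _ _ _ HX (root_portrait y sigma) (step v s) (inv s).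
rewrite step_inv invK; apply; apply: compat_edge_tau1 => //.
by rewrite step_inv us root_portraitE // /root_portrait (taus_teq hs uv)
  /tau_letters foldl_rcons.
Qed.

Lemma perm_labels n (c : X n) :
  perm_eq (enum [set l (edge c (cube0 n) i) | i in 'I_n]%SET)
    [seq l (edge c (cube0 n) i) | i <- enum 'I_n].
Proof.
apply: uniq_perm; first exact: enum_uniq.
  by have /andP[] := clique_labels HX c (cube0 n) (enum_uniq 'I_n).
move=> s; rewrite mem_enum; apply/imsetP/mapP => -[i _ ->]; exists i => //.
by rewrite mem_enum.
Qed.

Lemma clique_dlabel (d : Defs.diagonal X) : clique cm (enum (dlabel l d)).
Proof.
apply: clique_enum => s t /imsetP [i _ ->] /imsetP [j _ ->] ij.
apply/(commutingP HX)/cm_edge; by apply: contraNneq ij => ->.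
Qed.

Lemma dtgt_run (d : Defs.diagonal X) : dtgt d = run (dsrc d) (enum (dlabel l
  d)).
Proof.
have -> : dtgt d = run (dsrc d)
    [seq l (edge (dcube d) (cube0 _) i) | i <- enum 'I_(projT1 d).+1].
  rewrite -(vertex_run HX _ _ (enum_uniq _)) /dtgt; congr vertex.
  by apply/ffunP => k; rewrite flipsE ?enum_uniq // mem_enum !ffunE.
apply/weq_run/(teq_weq hcm)/teq_sym/(clique_teq hcm);
  first exact: clique_dlabel.
exact: perm_labels.
Qed.

Lemma mem_dlabel s (d : Defs.diagonal X) : s \in dlabel l d ->
  exists i, edge (dcube d) (cube0 _) i = eg (dsrc d) s.
Proof.
move=> /imsetP [i _ ->]; exists i.
by rewrite {1}(egE HX (edge _ _ _)) esrc_edge.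
Qed.

Lemma diagonal_ex v a : Sigma l a -> exists d : Defs.diagonal X,
  dsrc d = v /\ dlabel l d = a.
Proof.
move=> [a0 ca]; have : 0 < #|a| by rewrite card_gt0.
case E : #|a| => [//|n] _.
have /set0Pn [s0 _] := a0.
have sz : size (enum a) = n.+1 by rewrite -cardE.
have na i : nth s0 (enum a) (i : 'I_n.+1) \in a.
  by rewrite -mem_enum mem_nth // sz.
have [|c [vc lc]] := @cell_ex _ _ _ _ HX v n.+1 (fun i => nth s0 (enum a) i).
  move=> i j ij; apply/(commutingP HX)/ca => //.
  by rewrite nth_uniq ?sz ?enum_uniq.
exists (existT (fun n => X n.+1) n c); split=> //; apply/setP => s.
apply/imsetP/idP => [[i _ ->]|]; first by rewrite lc.
rewrite -mem_enum => /(nthP s0) [i]; rewrite sz => isz <-.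
by exists (Ordinal isz); rewrite ?lc.
Qed.

Definition flat (w : seq {set Sigma0}) : seq Sigma0 :=
  flatten [seq enum (b : {set Sigma0}) | b <- w].

Lemma flat_cat w w' : flat (w ++ w') = flat w ++ flat w'.
Proof. by rewrite /flat map_cat flatten_cat. Qed.

Lemma flat_rcons w b : flat (rcons w b) = flat w ++ enum b.
Proof. by rewrite -cats1 flat_cat /flat /= cats0. Qed.

Lemma cube_path_run v q x : cube_path v q x -> x = run v (flat (path_word l q)).
Proof.
elim: q v => [v ->|d q IH v /= [<- /IH ->]] //.
by rewrite /flat /= run_cat -dtgt_run.
Qed.

Lemma cube_path_cat v q q' x : cube_path v (q ++ q') x ->
  cube_path (run v (flat (path_word l q))) q' x.
Proof.
elim: q v => // d q IH v /= [<- /IH].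
by rewrite [flat (_ :: _)]/flat /= run_cat -dtgt_run.
Qed.

Lemma inv_neq s : inv s != s.
Proof. by apply/eqP; exact: (label_inv_neq (hom_adm HX)). Qed.

(** A cancellable pair [s], [inv s] comes from two different cubes, as letters of one cube commute.
    Since [s] commutes with everything in between, both cubes meet the same hyperplane. *)
Lemma flat_red v q x : cube_path v q x -> ~ crosses_twice q ->
  red inv cm (flat (path_word l q)).
Proof.
move=> vq nq; apply/(redP hcm) => u s u' u'' flatE; apply/negP => su';
  apply: nq.
have flatE' : flatten [seq enum (dlabel l d) | d <- q] = u ++ s :: u' ++ inv s
  :: u''.
  by rewrite -flatE /flat /path_word -map_comp.
have [w1 [d [w2 [u1 [u2 [qE dE uE u'E]]]]]] := flatten_map_split flatE'.
have sd : s \in dlabel l d by rewrite -mem_enum dE mem_cat mem_head orbT.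
have cl := clique_dlabel d.
have others t : t \in enum (dlabel l d) -> t != s -> cm s t.
  move: cl => /andP[_ /allP /(_ s)]; rewrite mem_enum => /(_ sd) /allP cs tt.
  by have := cs t tt; rewrite eq_sym; case: (eqVneq t s).
have [[u3 [u2E _]]|[u3 [u'E' w2E]]] := cat_split (esym u'E).
  have : cm s (inv s).
    by apply: others (inv_neq s); rewrite dE u2E !(mem_cat, inE) eqxx !orbT.
  by rewrite (com_invr hcm) (com_irr hcm).
have [w3 [d' [w4 [u4 [u5 [w2E' d'E u3E _]]]]]] := flatten_map_split w2E.
have sd' : inv s \in dlabel l d' by rewrite -mem_enum d'E mem_cat mem_head orbT.
have [i iE] := mem_dlabel sd; have [j jE] := mem_dlabel sd'.
have [dv vd'] : dsrc d = run v (flat (path_word l w1)) /\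
    cube_path (dtgt d) w2 x.
  by move: vq; rewrite qE => /cube_path_cat /=.
have {vd'} dv' : dsrc d' = run (dtgt d) (flat (path_word l w3)).
  by move: vd'; rewrite w2E' => /cube_path_cat /= [].
exists w1, d, w3, d', w4, (dual_hyperplane (eg (dsrc d) s)); split.
- by rewrite qE w2E'.
- exact: hyperplane_dual.
- by exists (eg (dsrc d) s); [rewrite -iE;
  exact: edge_of_edge|exact: dual_refl].
exists (eg (dsrc d') (inv s)); first by rewrite -jE; exact: edge_of_edge.
(* The hyperplane is taken at the source of [d], so the letters of [d] that precede [s] have to be
   passed as well. *)
have su1 : all (cm s) u1.
  apply/allP => t tu1; apply: others; first by rewrite dE mem_cat tu1.
  apply/eqP => ts; move: cl;
    rewrite /clique dE cat_uniq => /andP[/and3P[_ + _] _].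
  by rewrite /= -ts tu1.
have suu : all (cm s) (u1 ++ u2 ++ flat (path_word l w3)).
  rewrite !all_cat su1; move: su'; rewrite u'E' u3E !all_cat.
  by rewrite /flat /path_word -map_comp => /and3P[-> -> _].
rewrite dv' dtgt_run dE -run_cat -!catA.
rewrite -[X in dual_hyperplane _ (eg X _)]/(run _ _) run_cat /= run_step.
  by rewrite -erev_eg -run_cat; apply/dual_erev/dual_run.
by move: suu; rewrite all_cat => /andP[].
Qed.

End Roots.

(** * The automorphisms of the theorem *)

Section Automorphisms.
Variables (X : cubeComplex) (Sigma0 : finType) (inv : Sigma0 -> Sigma0)
  (l : X 1 -> Sigma0).
Hypothesis HX : homogeneous inv l.
Let invK := hom_invK HX.
Let hcm := cm_commutation HX.
Local Notation cm := (label_comm l).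
Local Notation step := (step_to HX).
Local Notation run := (endpoint HX).
Local Notation N := (geodesic HX).
Local Notation eg := (edge_from HX).
Local Notation label_iso := (@label_iso X Sigma0 l).
Local Notation tau1 := (tau_letter inv).
Local Notation taus := (tau_letters inv).
Local Notation root_portrait := (root_portrait HX).
Implicit Types (s t : Sigma0) (sigma : {perm Sigma0}) (pi : X 0 -> {perm
  Sigma0})
  (a b : {set Sigma0}) (u : seq Sigma0).
Variable o : X 0.

Lemma word_end_run w x : word_end l o w x -> x = run o (flat w).
Proof. by move=> [q /(cube_path_run HX) -> <-]. Qed.

Lemma normal_red w : normal_word l o w -> red inv cm (flat w).
Proof. by move=> [q [x [oq <- [nq _]]]]; exact: flat_red HX _ _ _ oq nq. Qed.

Lemma word_end_rcons w b x : word_end l o (rcons w b) x ->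
  exists d : Defs.diagonal X,
    [/\ word_end l o w (dsrc d), dlabel l d = b & dtgt d = x].
Proof.
move=> [q]; elim/last_ind: q => [_|q d _]; first by case: w.
rewrite -cats1 => oq; rewrite /path_word map_cat cats1 => /rcons_inj [<- <-].
exists d; have := cube_path_cat HX oq => -[_ /= ->]; split=> //.
exists q => //; elim: q o oq => [|e q IH] v //=; first by move=> [<-].
by move=> [<- /IH]; split.
Qed.

Lemma portrait_at_of (g : aut X) w sigma :
  (forall e, esrc e = w -> l (g 1 e) = sigma (l e)) -> portrait_at l g w sigma.
Proof.
move=> gw d dw; apply/setP => s; apply/imsetP/imsetP.
  move=> [i _ ->]; exists (l (edge (dcube d) (cube0 _) i));
    first exact: imset_f.
  by rewrite -gw ?esrc_edge // aut_face.
move=> [_ /imsetP [i _ ->] ->]; exists i => //.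
by rewrite -gw ?esrc_edge // aut_face.
Qed.

Lemma taus_word sigma w : label_iso sigma ->
  (forall b, b \in w -> clique cm (enum b)) ->
  foldl (tau inv) sigma w = taus sigma (flat w).
Proof.
elim: w sigma => // b w IH sigma hs cw.
rewrite /flat /= -/(flat w) taus_cat (tauE HX) //; last exact/cw/mem_head.
apply: IH; first exact: taus_iso.
by move=> c cw'; apply: cw; rewrite inE cw' orbT.
Qed.

Lemma word_end_clique w x b : word_end l o w x -> b \in w -> clique cm (enum b).
Proof.
move=> [q _ <-]; elim: q => //= d q IH; rewrite inE => /orP[/eqP ->|/IH //].
exact: (clique_dlabel HX).
Qed.

Lemma A_root_ex sigma : label_iso sigma -> exists g : aut X,
  is_A_root inv l o sigma g /\
  forall e, l (g 1 e) = root_portrait o sigma (esrc e) (l e).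
Proof.
move=> hs; have [g [go gl]] := portrait_aut o (root_portraitP HX o hs).
exists g; split=> //; split=> // w x nw wx; apply: portrait_at_of => e ex.
rewrite gl ex taus_word //; last by move=> b; exact: word_end_clique wx.
by rewrite (word_end_run wx) root_portraitE //; exact: normal_red.
Qed.

(** * The automorphism belonging to a one-letter word *)

Section Clique.
Variables (a : {set Sigma0}) (sigma : {perm Sigma0}).
Hypotheses (Sa : Sigma l a) (hs : label_iso sigma).
(** A letterwise form of compatibility, as the density argument provides it; [compatible_fix]
    derives [compatible] from it. *)
Hypothesis fix_a : forall s, s \in a ->
  sigma (inv s) = inv s /\ forall t, cm s t -> sigma t = t.

Let y := run o (enum a).
Let ca : clique cm (enum a). Proof. by apply: (clique_enum HX); case: Sa. Qed.

(* [z] is separated from [o] by the hyperplane of the edge with label [s] at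
  [o] *)
Definition first s z := hd cm s (N o z).

Lemma first_o s : ~ first s o.
Proof.
move=> /hd_mem h; have := h inv hcm;
  rewrite (teq_mem hcm (N_teq HX o (u := [::]) I)).
by [].
Qed.

Lemma first_y s : s \in a -> first s y.
Proof.
move=> sa; apply: hd_teq (teq_sym (N_teq HX o (clique_red hcm ca))) _.
have sea : s \in enum a by rewrite mem_enum.
have [p [q [aE sp]]] := mem_split_first sea.
apply/(hdP hcm); exists p, q; split=> //; apply/allP => t tp.
have /andP[_ /allP/(_ s sea)/allP/(_ t)] := ca.
by rewrite aE mem_cat tp => /(_ isT) /orP[/eqP st|//]; rewrite st tp in sp.
Qed.

(** A further last letter [t] makes [s] a new first letter only if [t] is [s] and passes the whole
    word; then the edge is dual to the hyperplane. *)
Lemma first_edge s e : ~ dual_hyperplane (eg o s) e ->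
  first s (esrc e) <-> first s (etgt e).
Proof.
suff key z t : red inv cm (rcons (N o z) t) ->
    ~ dual_hyperplane (eg o s) (eg z t) -> first s z <-> first s (step z t).
  rewrite (etgtE HX) {1}(egE HX e); move: (esrc e) (l e) => z t nH.
  (* Orient the edge so that it leads away from [o]. *)
  have [rt|[u zu ru]] := red_rconsP hcm t (N_red HX o z); first exact: key.
  have zE : z = run o (rcons u (inv t)).
    by rewrite -{1}(run_N HX o z); exact/weq_run/(teq_weq hcm).
  have tE : step z t = run o u.
    by have := step_inv HX (run o u) (inv t); rewrite invK -run_rcons -zE.
  rewrite -{1}(step_inv HX z t); apply: iff_sym; apply: key.
    apply: (red_teq hcm) (N_red HX o z); apply: teq_trans zu _.
    rewrite -!cats1 tE; apply: teq_cat => //; apply: teq_sym; exact: N_teq.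
  by move=> /dual_erev; rewrite erev_eg invK step_inv.
move=> rt nH.
have NE : teq cm (N o (step z t)) (N o z ++ [:: t]).
  rewrite cats1 -{1}(run_N HX o z) -run_rcons; exact: N_teq.
split=> [h|]; first by apply: hd_teq (teq_sym NE) _; exact: hd_cat.
move=> /(hd_teq NE) /(hdP hcm) [p [q [NzE sp]]].
case/lastP: q NzE => [|q r]; last first.
  rewrite -rcons_cons -rcons_cat cats1 => /rcons_inj [zE _].
  by rewrite /first zE; apply/(hdP hcm); exists p, q.
rewrite !cats1 => /rcons_inj [pE tE]; case: nH; rewrite tE -(run_N HX o z) pE.
exact: dual_run.
Qed.

Lemma first_side s v w : same_side (dual_hyperplane (eg o s)) v w ->
  first s v <-> first s w.
Proof.
move=> [q]; elim: q v => [v -> //|e q IH v /= [<- eq] nq].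
rewrite first_edge; last exact: (nq [::] e q erefl).
by apply: IH => // p1 e' p2 qE; apply: (nq (e :: p1) e' p2); rewrite qE.
Qed.

Lemma y_split s : s \in a -> exists2 u, all (cm s) u & y = run (step o s) u.
Proof.
move=> sa; have sea : s \in enum a by rewrite mem_enum.
have sp := perm_to_rem sea; exists (rem s (enum a)).
  by have /clique_cons [] := clique_perm sp ca.
suff : run o (enum a) = run o (s :: rem s (enum a)) by [].
exact/weq_run/(teq_weq hcm)/(clique_teq hcm).
Qed.

Lemma last_hyperplane_dual s :
  s \in a -> last_hyperplane o y (dual_hyperplane (eg o s)).
Proof.
move=> sa; split; first exact: hyperplane_dual.
  have [u su yE] := y_split sa; exists (eg (run o u) s); first exact: dual_run.
  by exists (cube1 1); rewrite yE run_step.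
by move=> /first_side os; apply: (@first_o s); apply/os; exact: first_y.
Qed.

(** The cube with label [a] at [o] ends at [y]. A hyperplane missing it cannot separate [o] from
    [y], and one that meets it crosses one of its edges at [o]. *)
Lemma last_hyperplaneP H : last_hyperplane o y H ->
  exists2 s, s \in a & H = dual_hyperplane (eg o s).
Proof.
move=> [hH _ oy]; have [d [do' da]] := diagonal_ex HX o Sa.
have Hd : Defs.meets H (dcube d).
  apply: contra_notP oy => nH; rewrite -[o in same_side _ o _]do'.
  by rewrite /y -da -do' -(dtgt_run HX); exact: same_side_cell.
have [i Hi] := meetsP (cube0 _) hH Hd.
exists (l (edge (dcube d) (cube0 _) i)).
  by rewrite -da; apply: imset_f.
rewrite (hyperplane_eq hH Hi); congr dual_hyperplane.
by rewrite {1}(egE HX (edge _ _ _)) esrc_edge -/(dsrc d) do'.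
Qed.

Let C z := in_last_halfspaces o y z.

Lemma C_first z s : C z -> s \in a -> first s z.
Proof.
move=> Cz sa; apply/(first_side (Cz _ (last_hyperplane_dual sa))).
exact: first_y.
Qed.

Lemma C_gate z : C z -> exists n, teq cm (N o z) (enum a ++ n).
Proof.
move=> Cz; apply: (clique_hd hcm ca) => s; rewrite mem_enum => sa.
exact: C_first.
Qed.

(** As [z] lies beyond the hyperplane, it is the far end of the crossing edge. So letters commuting
    with [s] lead from [y] to [z]; [sigma] fixes them, and the translated portrait does not change
    on the way. *)
Lemma C_boundary z s r : s \in a -> first s z ->
  dual_hyperplane (eg o s) (eg z r) -> r = inv s /\ root_portrait y sigma z =
    sigma.
Proof.
move=> sa fz /dualP [u su [E|E]].
  have zE : z = run o u by have := congr1 (@esrc X) E; rewrite !eg_src.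
  move: fz => /hd_mem; rewrite zE.
  have := N_teq HX o (nf_red hcm u); rewrite run_nf.
  move=> /(teq_mem hcm) -> /(_ inv hcm).
  by move=> /(allP (nf_sub hcm su)); rewrite (com_irr hcm).
have zE : z = run o (s :: u) by have := congr1 (@esrc X) E; rewrite !eg_src.
have rE : r = inv s by have := congr1 l E; rewrite !eg_lab.
split=> //; have [u' su' yE] := y_split sa.
have {}zE : z = run y (winv inv u' ++ u).
  rewrite run_cat yE -[run (run _ u') _]run_cat.
  rewrite (weq_run HX _ (weq_winvr _ _ _)) zE.
  by [].
have sw : all (cm s) (nf inv cm (winv inv u' ++ u)).
  by apply: (nf_sub hcm); rewrite all_cat (all_winv hcm) su' su.
rewrite zE -run_nf root_portraitE //; last exact: (nf_red hcm).
apply: taus_fix => t /(allP sw) st; have [_ h] := fix_a sa.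
by rewrite !h // (com_invr hcm).
Qed.

(** A closed form of the recursive portrait: the vertices of types 2 and 3 together form [C]. *)
Definition A_pi z : {perm Sigma0} :=
  if `[< C z >] then root_portrait y sigma z else 1%g.

Lemma A_portraitP : portrait HX A_pi.
Proof.
have rootP := root_portraitP HX y hs.
(* On an edge leaving [C] the action jumps from [sigma] to 1; by [fix_a] both agree on the letters
   concerned. *)
have out v s : C v -> ~ C (step v s) -> compat_edge HX A_pi v s.
  move=> Cv nC; have [H lH nH] : exists2 H, last_hyperplane o y H & ~ same_side
    H y (step v s).
    by have /existsNP [H /not_implyP [lH nH]] := nC; exists H.
  have Hv : H (eg v s).
    apply: contra_notP nH => nH; apply: same_side_trans (Cv H lH) _.
    by have := same_side_edge nH; rewrite eg_src.
  have [t ta HE] := last_hyperplaneP lH; rewrite HE in Hv.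
  have [sE pE] := C_boundary ta (C_first Cv ta) Hv; have [f1 f2] := fix_a ta.
  rewrite /compat_edge /A_pi asboolF // asboolT // pE perm1 sE f1; split=> // r.
  by rewrite (com_inv hcm) perm1 => /f2 ->.
split=> [v s|v]; last by rewrite /A_pi; case: ifP => _;
  [exact: rootP.2|move=> s t; rewrite !perm1].
have [Cv|nCv] := pselect (C v); have [Cs|nCs] := pselect (C (step v s)).
- by have := rootP.1 v s; rewrite /compat_edge /A_pi !asboolT.
- exact: out.
- have := @compat_edge_sym _ _ _ _ HX A_pi (step v s) (inv s).
  by rewrite step_inv invK; apply; apply: out; rewrite ?step_inv.
- by rewrite /compat_edge /A_pi !asboolF // !perm1; split=> // t;
  rewrite !perm1.
Qed.

Lemma A_portrait_A_pi w (rho : {perm Sigma0}) : A_portrait inv l o y sigma w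
  rho ->
  forall x, word_end l o w x -> A_pi x = rho.
Proof.
elim=> {w rho} [w x _ wx nC|w x _ wx [Cx [H lH Hx]]|w b x rho nw wx [nC n2] _
  IH] x' wx'.
- by rewrite (word_end_run wx') -(word_end_run wx) /A_pi asboolF.
- rewrite (word_end_run wx') -(word_end_run wx) /A_pi asboolT //.
  have [hH _ _] := lH; have [s sa HE] := last_hyperplaneP lH.
  have [n [c [Hc [x0 xE]]]] := Hx.
  have [i] := meetsP x0 hH Hc; rewrite (egE HX (edge _ _ _)) esrc_edge -xE HE.
  by move=> /(C_boundary sa (C_first Cx sa)) [].
- have Cx : C x by apply: contrapT.
  have {wx' x'} -> : x' = x by rewrite (word_end_run wx') -(word_end_run wx).
  have [d [wd db dx]] := word_end_rcons wx.
  (* Otherwise the last cube would meet one of the hyperplanes of [y], and [x] would lie in its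
     carrier, hence be of type 2. *)
  have Cd : C (dsrc d).
    move=> H lH; apply: contrapT => nH; apply: n2; split=> //; exists H => //.
    exists _, (dcube d); split; last by exists (cube1 _); rewrite -dx.
    apply: contrapT => nm; apply: nH; apply: same_side_trans (Cx H lH) _.
    by rewrite -dx; exact: same_side_cell.
  have := IH _ wd; rewrite /A_pi !asboolT // => <- {IH}.
  have [n dn] := C_gate Cd.
  have rdn := red_teq hcm dn (N_red HX o (dsrc d)).
  have dE : dsrc d = run y n.
    by rewrite -(run_N HX o (dsrc d)) -run_cat; exact/weq_run/(teq_weq hcm).
  have rwb := normal_red nw; rewrite flat_rcons in rwb.
  (* With its prefix [a] removed, the reduced word for [x] is a reduced word from [y], on which
     [root_portrait] can be evaluated. *)
  have rn : red inv cm (n ++ enum b).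
    apply: (red_catr (u := enum a)); rewrite catA.
    apply: (red_teq hcm _ rwb); apply: teq_cat => //;
      apply: (@red_teq_run _ _ _ _ HX o) => //.
      exact: red_catl rwb.
    by rewrite -(word_end_run wd) run_cat -dE.
  rewrite -dx (dtgt_run HX) db dE -run_cat !root_portraitE ?taus_cat //;
    last first.
    exact: red_catl rn.
  rewrite (tauE HX) //; first exact: taus_iso.
  by rewrite -db; exact: (clique_dlabel HX).
Qed.

(** Some hyperplane, that of an [s] in [a], meets both cubes. So [b] contains [inv s], and its other
    letters and all letters commuting with [b] commute with [s]. *)
Lemma compatible_fix : compatible l o sigma [:: a].
Proof.
move=> b [_ cb] [q [x [oq]]].
case: q oq => [//|d [//|d' [|//]]] [do' [dd' _]] [da db] [p1 [e [p2 [e' [p3 [H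
  [qE hH He He']]]]]]].
have [ee ee'] : d = e /\ d' = e'.
  by move: qE; case: p1 => [|? [|? []]] //; case: p2 => [|? []] // [-> ->].
subst e e'.
have [i Hi] := meetsP (cube0 _) hH He; have [j Hj] := meetsP (cube0 _) hH He'.
have sa : l (edge (dcube d) (cube0 _) i) \in a by rewrite -da; apply: imset_f.
have rb : l (edge (dcube d') (cube0 _) j) \in b by rewrite -db; apply: imset_f.
rewrite (hyperplane_eq hH Hi) in Hj.
rewrite (egE HX (edge _ _ i)) esrc_edge -/(dsrc d) do' in Hj.
rewrite (egE HX (edge _ _ j)) esrc_edge -/(dsrc d') dd' (dtgt_run HX) do' da in
  Hj.
move: Hj sa rb; move: (l (edge _ _ i)) (l (edge _ _ j)) => s r Hj sa.
have [-> _] := C_boundary sa (first_y sa) Hj => sb.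
have [f1 f2] := fix_a sa.
split=> [t tb|c _ bc t tc].
  have [<- //|st] := eqVneq (inv s) t.
  by apply: f2; rewrite -(com_inv hcm); exact/(commutingP HX)/cb.
by apply: f2; rewrite -(com_inv hcm); exact/(commutingP HX)/bc.
Qed.

(** The last two properties are those that density needs: the action at the end of [a], and
    triviality at the vertices that no reduced word starting with [a] reaches. *)
Lemma A_ex : exists g : aut X,
  [/\ compatible l o sigma [:: a], is_A inv l o [:: a] sigma g,
      forall s, l (g 1 (eg (run o (enum a)) s)) = sigma s &
      forall z s, l (g 1 (eg z s)) <> s ->
        exists n, teq cm (N o z) (enum a ++ n)].
Proof.
have [g [go gl]] := portrait_aut o A_portraitP.
exists g; split=> [||s|z s].
- exact: compatible_fix.
- split=> //; have [d [do' da]] := diagonal_ex HX o Sa.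
  exists y; first by exists [:: d]; rewrite /= ?da // (dtgt_run HX) do' da.
  move=> w x pi wx wpi; apply: portrait_at_of => e ex.
  by rewrite gl ex (A_portrait_A_pi wpi wx).
- rewrite gl eg_src eg_lab /A_pi asboolT; last by move=> H _;
  exact: same_side_refl.
  by rewrite (root_portraitE HX y (u := [::])).
- rewrite gl eg_src eg_lab /A_pi; case: asboolP => [Cz _|_];
  last by rewrite perm1.
  exact: C_gate.
Qed.

End Clique.
End Automorphisms.

(** * The compact-open topology *)

Section Topology.
Variables (R : realType) (X : cubeComplex).
Local Open Scope ring_scope.

(** The sets of maps agreeing with [f] on a compact set generate a filter that converges to [f]. *)
Lemma nbhs_compact_open (T U : topologicalType) (f : {compact-open, T -> U})
    (A : set {compact-open, T -> U}) :
  nbhs f A -> exists2 K : set T, compact K &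
    forall g : T -> U, (forall x, K x -> g x = f x) -> A g.
Proof.
pose F : set_system {compact-open, T -> U} :=
  filter_from (@compact T) (fun K => [set g | forall x, K x -> g x = f x]).
have FF : Filter F.
  apply: filter_from_filter; first by exists set0; exact: compact0.
  move=> K L cK cL; exists (K `|` L); first exact: compactU.
  by move=> g gf; split=> x Kx; apply: gf; [left|right].
have Ff : F --> f.
  apply/compact_open_cvgP => K O cK oO fKO; exists K => //.
  by move=> g gf _ [x Kx <-]; rewrite gf//; apply: fKO; exists x.
by move=> /Ff [K cK KA]; exists K => // g gf; apply: KA.
Qed.

(** * Open stars of vertices *)

Definition near_corner n (t : 'rV[R]_n) (x : cube n) : Prop :=
  forall i, `|t ord0 i - (x i)%:R| < 1.

Definition star_pre (v : X 0) (y : cubes R X) : Prop :=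
  let: existT c t := y in
  exists2 x, vertex (projT2 c) x = v & near_corner (val t) x.


Lemma affine_out m n (f : embedding m n) (t : 'rV[R]_m) k :
  (forall x, f x k = f (cube0 m) k) ->
  affine f t ord0 k = (f (cube0 m) k)%:R.
Proof.
by move=> fk; rewrite mxE big1 ?addr0 // => i _; rewrite fk subrr mulr0.
Qed.

Lemma affine_in m n (f : embedding m n) (t : 'rV[R]_m) k i (y : cube m) :
  (forall x, f x k = f (cube0 m) k (+) x i) ->
  `|affine f t ord0 k - (f y k)%:R| = `|t ord0 i - (y i)%:R|.
Proof.
move=> fk; rewrite mxE (bigD1 i) //= big1 => [|j ji].
  rewrite (fk (cubeflip _ _)) (fk y) !ffunE eqxx addr0; case: (f _ k) => /=.
    by rewrite -normrN; congr (`|_|); case: (y i) => /=; lra.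
  by congr (`|_|); case: (y i) => /=; lra.
by rewrite (fk (cubeflip _ _)) !ffunE [i == j]eq_sym (negPf ji) !addbF subrr
  mulr0.
Qed.

Lemma near_affine m n (f : embedding m n) (t : 'rV[R]_m) (y : cube m) :
  near_corner t y -> near_corner (affine f t) (f y).
Proof.
have [K [_ fK fnK]] := emb_coords f => ty k.
have [/codomP [i ->]|kK] := boolP (k \in codom K).
  by rewrite (@affine_in _ _ f t (K i) i).
by rewrite affine_out ?fnK // ?subrr ?normr0 // => x; exact: fnK.
Qed.

(** Where [f] is constant the coordinate of the point is 0 or 1, so distance less than 1 from [x]
    forces equality, and [x] lies on the face. *)
Lemma affine_near m n (f : embedding m n) (t : 'rV[R]_m) (x : cube n) :
  near_corner (affine f t) x -> exists2 y, x = f y & near_corner t y.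
Proof.
have [K [injK fK fnK]] := emb_coords f => tx.
pose y : cube m := [ffun i => f (cube0 m) (K i) (+) x (K i)].
have xE : x = f y.
  apply/ffunP => k; have [/codomP [i ->]|kK] := boolP (k \in codom K).
    by rewrite fK ffunE addKb.
  have := tx k; rewrite affine_out => [|z]; last exact: fnK.
  rewrite fnK //; case: (x k); case: (f _ k) => //=.
    by rewrite sub0r normrN normr1 ltxx.
  by rewrite subr0 normr1 ltxx.
exists y => // i; rewrite -(@affine_in _ _ f t (K i) i y) // -xE.
exact: tx.
Qed.

Lemma glued_star_pre v (y z : cubes R X) :
  clos_refl_sym_trans _ (@Defs.glue R X) y z -> star_pre v y <-> star_pre v z.
Proof.
elim=> [_ _ [m n f c s t st]|//|? ? _|? ? ? _ -> _ ->] //; last by move=> ->.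
split=> -[x /= <-].
  move=> /(near_affine f); rewrite -st => nx; exists (f x) => //.
  rewrite /vertex; apply: face_comp => a /=; apply/ffunP=> k.
  by rewrite /emb_fun /= !ffunE.
rewrite st => /affine_near [w -> nw]; exists w => //.
rewrite /vertex; apply/esym/face_comp => a /=; apply/ffunP=> k.
by rewrite /emb_fun /= !ffunE.
Qed.

Local Open Scope quotient_scope.

Definition star (v : X 0) : set (realization R X) :=
  fun z => star_pre v (repr z).

Lemma star_pi v (y : cubes R X) :
  star v (\pi_(realization R X) y) <-> star_pre v y.
Proof.
apply: glued_star_pre; apply/asboolP.
by have /eqquotP := reprK (\pi_(realization R X) y).
Qed.

Lemma solid_coord_continuous n (i : 'I_n) :
  continuous (fun t : @solid R n => val t ord0 i).
Proof.
move=> t; apply: (@continuous_comp _ _ _ (fun t : @solid R n =>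
  val t : 'rV[R]_n)
  (fun M : 'rV[R]_n => M ord0 i)); first exact: initial_continuous.
exact: coord_continuous.
Qed.

Lemma open_near_corner n (x : cube n) :
  open [set t : @solid R n | near_corner (val t) x].
Proof.
rewrite (_ : [set t | _] = \big[setI/setT]_(i < n)
   [set t : @solid R n | `|val t ord0 i - (x i)%:R| < 1]); last first.
  rewrite -bigcap_seq; apply/seteqP; split=> t /= h i => [_|]; first exact: h.
  by apply: h; rewrite /= mem_index_enum.
apply: (big_ind open) => [|A B|i _]; [exact: openT|exact: openI|].
rewrite (_ : [set t | _] = (fun t : @solid R n =>
  `|val t ord0 i - (x i)%:R|) @^-1` [set r | r < 1]) //.
apply: open_comp; last exact: open_lt.
move=> t _; apply: (@continuous_comp _ _ _
    (fun t : @solid R n => val t ord0 i - (x i)%:R) Num.norm).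
  apply: continuousB; first exact: solid_coord_continuous.
  exact: cst_continuous.
exact: norm_continuous.
Qed.

Lemma open_star v : open (star v).
Proof.
suff : open (star_pre v).
  rewrite /open /= /quotient_open => h.
  rewrite (_ : _ @^-1` _ = star_pre v) //.
  by apply/seteqP; split=> y /star_pi.
apply/sigT_openP => -[n c].
rewrite (_ : _ @^-1` _ =
  \bigcup_(x in [set x | vertex c x = v])
    [set t : @solid R n | near_corner (val t) x]); last first.
  by apply/seteqP; split=> [t [x ? ?]|t [x ? ?]]; exists x.
apply: bigcup_open => x _; exact: open_near_corner.
Qed.

Lemma star_cover (z : realization R X) : exists v, star v z.
Proof.
rewrite /star; case: (repr z) => c t.
(* Round every coordinate to a nearest integer. *)
pose x : cube (projT1 c) := [ffun i => 2%:R^-1 < val t ord0 i].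
exists (vertex (projT2 c) x); exists x => // i; rewrite ffunE.
have t01 : solid (val t) := set_valP t; have := t01 i.
rewrite ltr_norml; case: (ltP 2^-1 (val t ord0 i)) => /= ? /andP[? ?];
  apply/andP; split; lra.
Qed.

(** The unions of the stars with [N v <= n] form an open cover increasing with [n], so one [n]
    serves the whole compact set. *)
Lemma compact_star (N : X 0 -> nat) (K : set (realization R X)) :
  compact K -> exists n, forall z, K z -> exists2 v, (N v <= n)%N & star v z.
Proof.
move=> /compact_near_coveringP /(_ nat \oo
  (fun n z => exists2 v, (N v <= n)%N & star v z)).
case=> [z _|n _ h]; last by exists n => z; apply: h => /=.
have [v vz] := star_cover z.
exists (star v, [set n | (N v <= n)%N]) => /=.
  by split; [apply: open_nbhs_nbhs; split=> //; exact: open_star|exists (N v)].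
by move=> [z' n] /= [vz' Nv]; exists v.
Qed.

(** On the star of a vertex an automorphism is determined by its values on the cells at that
    vertex. *)
Lemma dense_of_approx (N : X 0 -> nat) (H : set (aut X)) :
  (forall (g : aut X) n, exists2 h, H h & forall m (c : X m) x,
     (N (vertex c x) <= n)%N -> h m c = g m c) ->
  dense (H : set (autTop R X)).
Proof.
move=> approx O [g Og] oO; case: oO => A oA OA; subst O.
have nA : nbhs (realization_aut (R := R) g : {compact-open, _ -> _}) A.
  by apply: open_nbhs_nbhs; split.
have [K cK KA] := nbhs_compact_open nA.
have [n Kn] := compact_star N cK.
have [h Hh hg] := approx g n.
exists h; split => //; apply: KA => z /Kn [v vn].
rewrite /star -[in realization_aut h z](reprK z) -[in realization_aut g
  z](reprK z).
rewrite !realization_autE; case: (repr z) => c t [x /= vE _].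
by congr (\pi _); rewrite /cubes_aut (hg _ _ x) ?vE.
Qed.

End Topology.

(** * Density *)

Section Subgroups.
Variable G : groupType.
Implicit Types (A H : set G).

Lemma generated_is_subgroup A : is_subgroup (generated_subgroup A).
Proof.
split; first by move=> H [[]].
by move=> x y hx hy H HA; have [[_ sH] _] := HA; apply: sH;
  [exact: hx|exact: hy].
Qed.

Lemma sub_generated A : A `<=` generated_subgroup A.
Proof. by move=> x Ax H [_]; apply. Qed.

Lemma generated_sub A H : is_subgroup H -> A `<=` H -> generated_subgroup A
  `<=` H.
Proof. by move=> sH AH x; apply. Qed.

Lemma subgroup_inv H x : is_subgroup H -> H x -> H (x^-1)%g.
Proof. by move=> [H1 HV] Hx; rewrite -[(x^-1)%g]mul1g; exact: HV. Qed.

Lemma subgroup_mul H x y : is_subgroup H -> H x -> H y -> H (x * y)%g.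
Proof.
by move=> sH Hx Hy; rewrite -[y]invgK; apply: sH.2 => //; exact: subgroup_inv.
Qed.

End Subgroups.

Section AutCells.
Variables (X : cubeComplex) (g : aut X).

Lemma aut_vertex n (c : X n) x : g 0 (vertex c x) = vertex (g n c) x.
Proof. exact: aut_face. Qed.

Lemma aut_edge n (c : X n) x i : g 1 (edge c x i) = edge (g n c) x i.
Proof. exact: aut_face. Qed.

Lemma aut_src e : g 0 (esrc e) = esrc (g 1 e). Proof. exact: aut_face. Qed.
Lemma aut_tgt e : g 0 (etgt e) = etgt (g 1 e). Proof. exact: aut_face. Qed.
Lemma aut_erev e : g 1 (erev e) = erev (g 1 e). Proof. exact: aut_face. Qed.

Lemma aut_corner e e' : corner e e' -> corner (g 1 e) (g 1 e').
Proof. by move=> [c [-> ->]]; exists (g 2 c); rewrite !aut_edge. Qed.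

Lemma aut_parallel e e' : parallel e e' -> parallel (g 1 e) (g 1 e').
Proof.
elim=> {e e'} [_ _ [c [-> ->]]|e|e e' _|e e' e'' _ ee' _].
- by rewrite !aut_edge; exact: parallel_flip.
- exact: parallel_refl.
- exact: parallel_sym.
- exact: parallel_trans.
Qed.

End AutCells.

Lemma deck_homogeneous (X Y : cubeComplex) (p : cubicalMap X Y)
    (Sigma0 : finType) (inv : Sigma0 -> Sigma0) (l : X 1 -> Sigma0) :
  nonpositively_curved Y -> universal_covering p ->
  admissible_labeling inv l -> (forall s, exists e, l e = s) ->
  (forall g, deck p g -> forall e, l (g 1 e) = l e) ->
  (forall v w, exists2 g, deck p g & g 0 v = w) ->
  homogeneous inv l.
Proof.
move=> Ynpc [pcov sc] adm surj deckl trans; split=> //.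
- exact: covering_npc pcov Ynpc.
- move=> v s; have [e <-] := surj s; have [g dg gv] := trans (esrc e) v.
  by exists (g 1 e); rewrite -aut_src gv deckl.
- move=> v c; have [g dg gv] := trans (vertex c (cube0 2)) v.
  by exists (g 2 c); rewrite -aut_vertex -!aut_edge !deckl.
Qed.

(** * Local actions of automorphisms *)

Section Local.
Variables (X : cubeComplex) (Sigma0 : finType) (inv : Sigma0 -> Sigma0)
  (l : X 1 -> Sigma0).
Hypothesis HX : homogeneous inv l.
Let hcm := cm_commutation HX.
Local Notation cm := (label_comm l).
Local Notation step := (step_to HX).
Local Notation run := (endpoint HX).
Local Notation N := (geodesic HX).
Local Notation eg := (edge_from HX).
Implicit Types (s t : Sigma0) (u : seq Sigma0) (g h k : aut X) (v z : X 0).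

Definition loc g v s := l (g 1 (eg v s)).

Lemma aut_eg g v s : g 1 (eg v s) = eg (g 0 v) (loc g v s).
Proof. by rewrite (egE HX (g 1 _)) -aut_src eg_src. Qed.

Lemma aut_step g v s : g 0 (step v s) = step (g 0 v) (loc g v s).
Proof. by rewrite /step_to aut_tgt aut_eg. Qed.

Lemma loc_mul g h v s : loc (g * h)%g v s = loc g (h 0 v) (loc h v s).
Proof. by rewrite /loc -aut_eg. Qed.

Lemma loc1 v s : loc 1%g v s = s.
Proof. exact: eg_lab. Qed.

Lemma locK g v : cancel (loc g v) (loc g^-1%g (g 0 v)).
Proof. by move=> s; rewrite -loc_mul mulVg loc1. Qed.

Lemma loc_cm g v s t : cm (loc g v s) (loc g v t) = cm s t.
Proof.
suff key h z s' t' : cm s' t' -> cm (loc h z s') (loc h z t').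
  by apply/idP/idP => [/(key (g^-1)%g (g 0 v))|/key //]; rewrite !locK.
by move=> /(corner_eg HX z) /(aut_corner h); exact: cm_corner.
Qed.

Lemma loc_compat g v s :
  loc g (step v s) (inv s) = inv (loc g v s) /\
  forall t, cm s t -> loc g (step v s) t = loc g v t.
Proof.
split; first by rewrite /loc -erev_eg aut_erev (label_rev (hom_adm HX)).
move=> t; rewrite (com_sym hcm) => /(parallel_eg HX v) /(aut_parallel g).
by move=> /parallel_sym /(label_parallel (hom_adm HX)).
Qed.

Definition locp g v : {perm Sigma0} := perm (can_inj (locK g v)).

Lemma locpE g v s : locp g v s = loc g v s. Proof. exact: permE. Qed.

Lemma locp_iso g v : label_iso l (locp g v).
Proof. by move=> s t; rewrite !locpE loc_cm. Qed.

Lemma aut_run g v u : (forall z s, loc g z s = s) -> g 0 (run v u) = run (g 0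
  v) u.
Proof.
move=> gl; elim/last_ind: u => // u s IH.
by rewrite !run_rcons aut_step IH gl.
Qed.

Lemma aut_eq_cell g h n (c : X n) x : g 0 (vertex c x) = h 0 (vertex c x) ->
  (forall s, loc g (vertex c x) s = loc h (vertex c x) s) -> g n c = h n c.
Proof.
move=> gh lgh; rewrite -(face_refl c x) !aut_face; congr face.
apply: (cell_eq HX); first by rewrite -!aut_face -!aut_vertex vertex_refl.
move=> i; rewrite -!aut_face -!aut_edge edge_refl.
by rewrite (egE HX (edge _ _ _)) esrc_edge; exact: lgh.
Qed.

Variable o : X 0.

Definition nrm v := size (N o v).

Lemma nrm_run u : red inv cm u -> nrm (run o u) = size u.
Proof. by move=> /(N_teq HX o) /(teq_size hcm). Qed.

Lemma nrm_eq0 v : nrm v = 0%N -> v = o.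
Proof. by move=> /size0nil v0; rewrite -(run_N HX o v) v0. Qed.

Lemma ball_fix k n : k 0 o = o ->
  (forall z s, nrm z < n -> loc k z s = s)%N ->
  forall z, (nrm z <= n)%N -> k 0 z = z.
Proof.
move=> ko kl z; rewrite /nrm -{2 3}(run_N HX o z).
elim/last_ind: (N o z) (N_red HX o z) => [//|u s IH] /(red_rcons hcm) [ru _].
rewrite size_rcons => un; rewrite run_rcons aut_step kl ?nrm_run //.
by rewrite IH // ltnW.
Qed.

(** Walks back from the end of [u] to [o]; meant for conjugates, whose evident fixed vertex is the
    end of [u]. *)
Lemma base_fix k u : red inv cm u -> k 0 (run o u) = run o u ->
  (forall z s, nrm z <= size u -> loc k z s = s)%N -> k 0 o = o.
Proof.
elim/last_ind: u => [//|u s IH] rus ku kl; have [ru _] := red_rcons hcm rus.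
apply: IH => // [|z t zu]; last by apply: kl; rewrite size_rcons ltnW.
have -> : run o u = step (run o (rcons u s)) (inv s).
  by rewrite run_rcons step_inv.
by rewrite aut_step ku kl // nrm_run.
Qed.

(** * Correcting an automorphism vertex by vertex *)

Section Density.
Variable H : set (aut X).
Hypotheses (sub_H : is_subgroup H)
  (H_deck : forall v w, exists2 g, H g & g 0 v = w /\ forall z s, loc g z s = s)
  (H_root : forall sigma g, label_iso l sigma -> is_A_root inv l o sigma g -> H
    g)
  (H_A : forall a sigma g, Sigma l a -> label_iso l sigma ->
    compatible l o sigma [:: a] -> is_A inv l o [:: a] sigma g -> H g).

Lemma correct k v : k 0 o = o ->
  (forall z s, nrm z < nrm v -> loc k z s = s)%N ->
  exists c, [/\ H c, forall z, (nrm z <= nrm v)%N -> c 0 z = z,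
    forall z s, (nrm z <= nrm v)%N -> z <> v -> loc c z s = s &
    forall s, loc c v s = loc k v s].
Proof.
move=> ko kl; case: (posnP (nrm v)) => [v0|v_gt0].
  have [g [Hg gl]] := A_root_ex HX o (locp_iso k v).
  have vo := nrm_eq0 v0; have go : g 0 o = o by case: Hg.
  exists g; split.
  - exact: H_root (locp_iso k v) Hg.
  - by move=> z; rewrite v0 leqn0 => /eqP /nrm_eq0 ->.
  - by move=> z s; rewrite v0 leqn0 => /eqP /nrm_eq0 ->; rewrite vo.
  - move=> s; rewrite /loc gl eg_src eg_lab vo.
    by rewrite (root_portraitE HX o (u := [::])) ?locpE //; exact: locp_iso.
(* The possible last letters of reduced words for [v]; they commute pairwise, so [v] is reached by
   some [W] followed by [a]. *)
pose a : {set Sigma0} := [set s | `[< hd cm s (rev (N o v)) >]]%SET.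
have aP s : reflect (hd cm s (rev (N o v))) (s \in a).
  by rewrite inE; exact: asboolP.
have ca : clique cm (enum a).
  rewrite /clique enum_uniq; apply/allP => s; rewrite mem_enum => /aP [w sw].
  apply/allP => t; rewrite mem_enum => /aP [w' tw']; case: eqVneq => //= st.
  by have [] := teq_diamond hcm st (teq_trans (teq_sym sw) tw').
have [w Nw] : exists w, teq cm (rev (N o v)) (enum a ++ w).
  by apply: (clique_hd hcm ca) => s; rewrite mem_enum => /aP.
pose W := rev w.
have NW : teq cm (N o v) (W ++ enum a).
  rewrite -(revK (N o v)); apply: teq_trans (teq_rev Nw) _.
  rewrite rev_cat; apply: teq_cat => //; apply: teq_sym.
  by apply: (clique_teq hcm ca); rewrite perm_sym perm_rev.
have rW : red inv cm (W ++ enum a) := red_teq hcm NW (N_red HX o v).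
have vE : v = run o (W ++ enum a).
  by rewrite -{1}(run_N HX o v); exact/weq_run/(teq_weq hcm).
have Sa : Sigma l a.
  split.
    apply/eqP => a0; move: v_gt0; rewrite /nrm;
      case/lastP E : (N o v) => [//|u s] _.
    have : s \in a by apply/aP; rewrite E rev_rcons; exists (rev u).
    by rewrite a0 inE.
  move=> s t sa ta st; apply/(commutingP HX).
  have /andP[_ /allP] := ca; move=> /(_ s);
    rewrite mem_enum => /(_ sa) /allP /(_ t).
  by rewrite mem_enum (negPf st) => /(_ ta).
have a_gt0 : (0 < size (enum a))%N by rewrite -cardE card_gt0; case: Sa.
(* Stepping back from [v] along [s] leads closer to [o], where [k] acts trivially; consistency along
   this edge gives the fixed letters at [v]. *)
have fix_a s : s \in a -> locp k v (inv s) = inv s /\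
    forall t, cm s t -> locp k v t = t.
  move=> /aP [u su]; have Nu : teq cm (N o v) (rcons (rev u) s).
    by rewrite -(revK (N o v)) -rev_cons; exact: teq_rev.
  have vu : v = step (run o (rev u)) s.
    by rewrite -run_rcons -{1}(run_N HX o v); exact/weq_run/(teq_weq hcm).
  have [ru _] := red_rcons hcm (red_teq hcm Nu (N_red HX o v)).
  have lu t : loc k (run o (rev u)) t = t.
    by apply: kl; rewrite nrm_run // /nrm (teq_size hcm Nu) size_rcons.
  have [p1 p2] := loc_compat k (run o (rev u)) s.
  rewrite locpE vu p1 lu; split=> // t st.
  by rewrite locpE p2.
have [A [compA isA Ay Az]] := A_ex HX o Sa (locp_iso k v) fix_a.
have HA := H_A Sa (locp_iso k v) compA isA.
(* The translation taking [o] to the start of the last cube, and the end of [a] to [v]. *)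
have [gam Hgam [gamo gaml]] := H_deck o (run o W).
have gamVl z s : loc gam^-1%g z s = s.
  have := locK gam (gam^-1%g 0 z) s; rewrite gaml.
  by rewrite -[gam 0 (_ 0 z)]/((gam * gam^-1)%g 0 z) mulgV.
pose c := (gam * A * gam^-1)%g.
have cl z s : loc c z s = loc A (gam^-1%g 0 z) s.
  by rewrite /c -mulgA !loc_mul gaml gamVl.
have gamE z : z = gam 0 (gam^-1%g 0 z).
  by rewrite -[RHS]/((gam * gam^-1)%g 0 z) mulgV.
(* Where [c] acts nontrivially, [W ++ enum a ++ n] leads to [z] for some [n] and is reduced by
   [red_catA]; so [z] is farther than [v] unless [n] is empty. *)
have cfar z s : (nrm z <= nrm v)%N -> z <> v -> loc c z s = s.
  move=> zv zNv; rewrite cl; apply: contrapT => /Az [n zn]; apply: zNv.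
  have zE : z = run o (W ++ enum a ++ n).
    rewrite run_cat -gamo -aut_run // {1}(gamE z); congr (gam 0 _).
    by rewrite -{1}(run_N HX o (_ 0 z)); exact/weq_run/(teq_weq hcm).
  have rn : red inv cm (W ++ enum a ++ n).
    apply: (red_catA hcm) => //.
      exact: (red_teq hcm zn (N_red HX o (gam^-1%g 0 z))).
    move=> s'; rewrite mem_enum => h; apply/aP.
    exact: hd_teq (teq_rev (teq_sym NW)) h.
  move: zv; rewrite zE nrm_run // /nrm (teq_size hcm NW) catA size_cat.
  by rewrite -{2}[size (W ++ _)]addn0 leq_add2l leqn0 => /nilP ->;
    rewrite cats0 -vE.
have nrmW : (size W < nrm v)%N.
  by rewrite /nrm (teq_size hcm NW) size_cat -{1}[size W]addn0 ltn_add2l.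
have cW : c 0 (run o W) = run o W.
  rewrite /c -[LHS]/(gam 0 (A 0 (gam^-1%g 0 (run o W)))) -gamo.
  rewrite -[gam^-1%g 0 _]/((gam^-1 * gam)%g 0 o) mulVg.
  by case: isA => -> _.
have lowl z s : (nrm z < nrm v)%N -> loc c z s = s.
  by move=> zv; apply: cfar; [exact: ltnW|move=> zE; rewrite zE ltnn in zv].
have co : c 0 o = o.
  apply: base_fix (red_catl rW) cW _ => z s zW.
  by apply: lowl; exact: leq_ltn_trans nrmW.
exists c; split=> //.
- apply: subgroup_mul => //; first exact: subgroup_mul.
  exact: subgroup_inv.
- exact: ball_fix co lowl.
- move=> s; rewrite cl -[RHS]locpE -Ay; congr (l (A 1 (eg _ _))).
  rewrite vE run_cat -gamo -aut_run //.
  by rewrite -[LHS]/((gam^-1 * gam)%g 0 _) mulVg.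
Qed.

(** Induction on the radius: the vertices of a sphere are treated one at a time, and [correct] does
    not disturb those already treated. *)
Lemma approx g n : exists h, [/\ H h, (h^-1 * g)%g 0 o = o &
  forall z s, (nrm z < n)%N -> loc (h^-1 * g)%g z s = s].
Proof.
elim: n => [|n [h [Hh ho hl]]].
  have [gam Hgam [gamo _]] := H_deck o (g 0 o); exists gam; split=> //.
  by rewrite -[LHS]/(gam^-1%g 0 (g 0 o)) -gamo -[LHS]/((gam^-1 * gam)%g 0 o)
    mulVg.
(* The sphere is enumerated by all words of length [n]; nonreduced ones end elsewhere, hence the
   condition on [nrm]. *)
suff [h' [Hh' h'o h'l h'n]] : exists h', [/\ H h', (h'^-1 * g)%g 0 o = o,
    forall z s, (nrm z < n)%N -> loc (h'^-1 * g)%g z s = s &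
    forall u, u \in [seq val w | w <- enum {: n.-tuple Sigma0}] ->
      nrm (run o u) = n ->
      forall s, loc (h'^-1 * g)%g (run o u) s = s].
  exists h'; split=> // z s; rewrite ltnS leq_eqVlt => /orP[/eqP zn|];
    last exact: h'l.
  rewrite -(run_N HX o z); apply: h'n; last by rewrite run_N.
  have sz : size (N o z) == n by rewrite -zn.
  by apply/mapP; exists (Tuple sz); rewrite ?mem_enum.
elim: [seq _ | _ <- _] => [|u L [h' [Hh' h'o h'l h'n]]]; first by exists h.
have [un|un] := eqVneq (nrm (run o u)) n; last first.
  exists h'; split=> // u'; rewrite inE => /orP[/eqP -> /eqP|]; last exact: h'n.
  by rewrite (negPf un).
set k := (h'^-1 * g)%g in h'o h'l h'n.
have [|c [Hc cz cl cu]] := @correct k (run o u) h'o.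
  by move=> z s; rewrite un; exact: h'l.
rewrite un in cz cl.
have kE : ((h' * c)^-1 * g = c^-1 * k)%g by rewrite invMg /k mulgA.
have kz z : (nrm z <= n)%N -> k 0 z = z by exact: ball_fix h'o h'l z.
have cV z s : (nrm z <= n)%N -> loc c^-1%g z (loc c z s) = s.
  by move=> zn; rewrite -{1}(cz z zn) locK.
exists (h' * c)%g; rewrite kE; split.
- exact: subgroup_mul.
- rewrite -[LHS]/(c^-1%g 0 (k 0 o)) h'o -{1}(cz o) ?(nrm_run (u := [::])) //.
  by rewrite -[LHS]/((c^-1 * c)%g 0 o) mulVg.
- move=> z s zn; rewrite loc_mul kz ?(ltnW zn) // h'l //.
  rewrite -{1}(cl z s) ?(ltnW zn) ?cV ?(ltnW zn) //.
  by move=> zu; rewrite zu un ltnn in zn.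
- move=> u' u'L u'n s; rewrite loc_mul kz ?u'n //.
  have [E|ne] := pselect (run o u' = run o u).
    by rewrite E -cu cV // un.
  move: u'L; rewrite inE => /orP[/eqP uE|u'L]; first by rewrite uE in ne.
  by rewrite h'n // -{1}(cl (run o u') s) ?u'n // cV ?u'n.
Qed.

Lemma approx_cells g n : exists2 h, H h & forall m (c : X m) x,
  (nrm (vertex c x) <= n)%N -> h m c = g m c.
Proof.
(* Radius [n.+1], since the action must be trivial at vertices of norm exactly [n] too. *)
have [h [Hh ho hl]] := approx g n.+1; exists h => // m c x cn.
have -> : g m c = h m ((h^-1 * g)%g m c).
  by rewrite -[RHS]/((h * (h^-1 * g))%g m c) mulgA mulgV mul1g.
congr (h m _); rewrite -[LHS]/((1 : aut X)%g m c).
apply: (@aut_eq_cell _ _ _ _ x) => [|s]; last by rewrite loc1 hl.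
by rewrite (ball_fix ho hl) // ltnW.
Qed.

End Density.
End Local.

Theorem theorem3 (R : realType) (S0 X : cubeComplex) (p : cubicalMap X S0)
    (Sigma0 : finType) (inv : Sigma0 -> Sigma0) (l : X 1 -> Sigma0) (o : X 0)
    (S : set (aut X)) :
  compact [set: realization R S0] ->
  connected [set: realization R S0] ->
  nonpositively_curved S0 ->
  special S0 ->
  universal_covering p ->
  admissible_labeling inv l ->
  (forall s, exists e, l e = s) ->
  (forall g, deck p g -> forall e, l (g 1 e) = l e) ->
  (forall v w, exists2 g, deck p g & g 0 v = w) ->
  finite_set S ->
  [set (g^-1)%g | g in S]%classic = S ->
  generated_subgroup S = deck p ->
  dense (generated_subgroup
    (S `|` [set g | exists2 sigma, label_isomorphism l sigma
                                 & is_A_root inv l o sigma g]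
       `|` [set g | exists a sigma,
              [/\ Sigma l a, label_isomorphism l sigma,
                  compatible l o sigma [:: a] & is_A inv l o [:: a] sigma g]])
    : set (autTop R X)).
Proof.
move=> _ _ npc _ cov adm surj deckl trans _ _ genS.
have HX := deck_homogeneous npc cov adm surj deckl trans.
set H := generated_subgroup _.
have sub_H : is_subgroup H by exact: generated_is_subgroup.
apply: (dense_of_approx (N := nrm HX o)) => g n.
apply: (approx_cells sub_H).
(* Deck transformations preserve labels, act transitively on vertices and lie in the subgroup
   generated by [S]. *)
- move=> v w; have [gam dgam gamv] := trans v w; exists gam; last first.
    by split=> // z s; rewrite /loc deckl // eg_lab.
  move: dgam; rewrite -genS; apply: generated_sub => // h Sh.
  by apply: sub_generated; left; left.
- move=> sigma h hs hA; apply: sub_generated; left; right; exists sigma => //.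
  exact/(label_isoP HX).
- move=> a sigma h Sa hs ca hA; apply: sub_generated; right; exists a, sigma.
  by split=> //; exact/(label_isoP HX).
Qed.
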